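(* Consider the optimization problem, the barrier $b$ and the iterates generated by the algorithm described in the context, under the assumptions stated there, with $\epsilon_{\rm p},\epsilon_{\rm d}>0$. Then $\inf_{k\in\mathbb{N}}\mu_k>0$ and exactly one of the following scenarios occurs: (A) either the algorithm terminates returning an $(\epsilon_{\rm p},\epsilon_{\rm d})$-KKT stationary point for the problem, (B) or it runs indefinitely with $s_k\le\epsilon_{\rm p}<p_k$ for all $k$ large enough, and $\alpha_k\nearrow\infty$. In the latter case, if $\operatorname{dom}q$ is closed and $q$ is continuous relative to it, then for any accumulation point $\bar x$ of $(x^k)$ one has that $(\bar x,q(\bar x))$ is KKT-stationary for the feasibility problem of minimizing $\|[c(x)]_+\|_1+\|c^{\rm eq}(x)\|_1$ over $(x,t)\in\operatorname{epi}q$, in the sense that $$(0,0)\in\partial\bigl[\|[c(\cdot)]_+\|_1+\|c^{\rm eq}(\cdot)\|_1\bigr](\bar x)\times\{0\}+N_{\operatorname{epi}q}(\bar x,q(\bar x)).$$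
   Context: Problem: minimize $q(x)$ over $x\in\mathbb{R}^n$ subject to $c(x)\le 0$, $c^{\rm eq}(x)=0$, where $q:\mathbb{R}^n\to\mathbb{R}\cup\{\pm\infty\}$ is proper and lower semicontinuous, $c:\mathbb{R}^n\to\mathbb{R}^m$ and $c^{\rm eq}:\mathbb{R}^n\to\mathbb{R}^{m_{\rm eq}}$ are continuously differentiable, and the infimum is finite. $\partial$ is the limiting (Mordukhovich) subdifferential, $N_E=\partial\iota_E$ the limiting normal cone of a set $E$ ($\iota_E$ the indicator function), $\operatorname{epi}q=\{(x,t)\in\mathbb{R}^n\times\mathbb{R}:t\ge q(x)\}$, $J$ the Jacobian, $[r]_+=\max\{0,r\}$, $[r]_-=\max\{0,-r\}$ (elementwise on vectors). Approximate KKT points: $\bar x$ is an $(\epsilon_{\rm p},\epsilon_{\rm d})$-KKT (stationary) point if there exist $\bar y\in\mathbb{R}^m$, $\bar y^{\rm eq}\in\mathbb{R}^{m_{\rm eq}}$ with $\operatorname{dist}(-Jc(\bar x)^\top\bar y-Jc^{\rm eq}(\bar x)^\top\bar y^{\rm eq},\partial q(\bar x))\le\epsilon_{\rm d}$, $\|[c(\bar x)]_+\|_\infty\le\epsilon_{\rm p}$, $\|c^{\rm eq}(\bar x)\|_\infty\le\epsilon_{\rm p}$, $\bar y\ge0$, and $\min\{\bar y_i,[c_i(\bar x)]_-\}\le\epsilon_{\rm p}$ for $i=1,\dots,m$. Barrier: $b:\mathbb{R}\to\mathbb{R}\cup\{\pm\infty\}$ is proper, lower semicontinuous, twice continuously differentiable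 on its domain $\operatorname{dom}b=(-\infty,0)$, with $b'>0$ and $b''>0$ there. $b^*(\tau)=\sup_t\{\tau t-b(t)\}$ is its convex conjugate. For $\rho^*>0$: $\psi_{\rho^*}(t)=\min_{z\ge0}\{\rho^*z+b(t-z)\}$, $\psi^{\rm eq}_{\rho^*}(t)=\min_{z\in\mathbb{R}}\{\rho^*z+b(t-z)+b(-t-z)\}$. For $\alpha,\mu>0$: $F_{\alpha,\mu}(x)=q(x)+\mu\sum_{i=1}^m\psi_{\alpha/\mu}(c_i(x))+\mu\sum_{j=1}^{m_{\rm eq}}\psi^{\rm eq}_{\alpha/\mu}(c^{\rm eq}_j(x))$. Algorithm: given $\epsilon_{\rm p},\epsilon_{\rm d}\ge0$, $\alpha_0,\mu_0>0$, $\varepsilon_0\ge\epsilon_{\rm d}$, $\delta_\alpha>1$, $\delta_\varepsilon,\delta_\mu\in(0,1)$, repeat for $k=0,1,\dots$: 1. Find (any) $x^k$ with $\operatorname{dist}(0,\partial F_{\alpha_k,\mu_k}(x^k))\le\varepsilon_k$ (such a point is assumed to exist; distance to $\emptyset$ is $\infty$). 2. Set $y^k_i=\mu_k\psi_{\alpha_k/\mu_k}'(c_i(x^k))$, $i=1,\dots,m$, and $y^{{\rm eq},k}_j=\mu_k(\psi^{\rm eq}_{\alpha_k/\mu_k})'(c^{\rm eq}_j(x^k))$, $j=1,\dots,m_{\rm eq}$. 3. Set $p_k=\max\{\|[c(x^k)]_+\|_\infty,\|c^{\rm eq}(x^k)\|_\infty\}$. 4. Let $s_k$ be the maximum absolute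 value, over all $i=1,\dots,m$ and $j=1,\dots,m_{\rm eq}$, of the quantities $\min\{y^k_i,[c_i(x^k)]_-\}$, $\min\{\alpha_k-y^k_i,[c_i(x^k)]_+\}$, $\min\{\alpha_k+y^{{\rm eq},k}_j,[c^{\rm eq}_j(x^k)]_-\}$, $\min\{\alpha_k-y^{{\rm eq},k}_j,[c^{\rm eq}_j(x^k)]_+\}$. 5. If $\varepsilon_k\le\epsilon_{\rm d}$, $p_k\le\epsilon_{\rm p}$ and $s_k\le\epsilon_{\rm p}$, stop and return $(x^k,y^k)$. 6. Set $\varepsilon_{k+1}=\max\{\delta_\varepsilon\varepsilon_k,\epsilon_{\rm d}\}$. 7. If $p_k>\max\bigl\{\epsilon_{\rm p},\,2(m+m_{\rm eq})\frac{-b^*(\alpha_k/\mu_k)}{\alpha_k/\mu_k}\bigr\}$ set $\alpha_{k+1}=\delta_\alpha\alpha_k$, else $\alpha_{k+1}=\alpha_k$. 8. If $s_k>\epsilon_{\rm p}$ or $\alpha_{k+1}=\alpha_k$ set $\mu_{k+1}=\delta_\mu\mu_k$, else $\mu_{k+1}=\mu_k$. *)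

(* Defs.v *)
From HB Require Import structures.
From mathcomp Require Import all_boot all_order all_algebra.
From mathcomp Require Import all_classical all_reals all_analysis.

Set Implicit Arguments.
Unset Strict Implicit.
Unset Printing Implicit Defensive.

Import Order.TTheory GRing.Theory Num.Theory.
Import numFieldNormedType.Exports.

Local Open Scope classical_set_scope.
Local Open Scope ring_scope.

(* Points of R^n are row vectors.  The canonical topology of ['rV[R]_n] is the
   usual one, but its library norm [`|_|] is the sup norm: it is used below only
   where the sup norm is meant, and distances are taken in [norm2]. *)

Definition dot (R : realType) (n : nat) (u v : 'rV[R]_n) : R :=
  \sum_i u 0 i * v 0 i.

Definition norm2 (R : realType) (n : nat) (u : 'rV[R]_n) : R :=
  Num.sqrt (dot u u).

Definition norm1 (R : realType) (n : nat) (u : 'rV[R]_n) : R :=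
  \sum_i `|u 0 i|.

(* [ereal_inf set0 = +oo], so the distance to the empty set is infinite. *)
Definition dist (R : realType) (n : nat) (x : 'rV[R]_n) (E : set 'rV[R]_n) :
    \bar R :=
  ereal_inf [set (norm2 (x - y))%:E | y in E].

Definition pos_part (R : realType) (r : R) : R := Num.max 0 r.
Definition neg_part (R : realType) (r : R) : R := Num.max 0 (- r).

Definition edom (R : realType) (T : Type) (f : T -> \bar R) : set T :=
  [set x | (f x < +oo)%E].

Definition proper_fun (R : realType) (T : Type) (f : T -> \bar R) : Prop :=
  (forall x, f x <> -oo%E) /\ edom f !=set0.

(* v is a regular (Frechet) subgradient of f at x:
   f y >= f x + <v, y - x> + o(|y - x|) as y tends to x. *)
Definition regular_subdiff (R : realType) (n : nat) (f : 'rV[R]_n -> \bar R)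
    (x : 'rV[R]_n) : set 'rV[R]_n :=
  [set v | f x \is a fin_num /\
    forall e : R, 0 < e -> \forall y \near x,
      (f x + (dot v (y - x) - e * norm2 (y - x))%:E <= f y)%E].

Definition subdiff (R : realType) (n : nat) (f : 'rV[R]_n -> \bar R)
    (x : 'rV[R]_n) : set 'rV[R]_n :=
  [set v | f x \is a fin_num /\
    exists xs vs : nat -> 'rV[R]_n,
      [/\ xs k @[k --> \oo] --> x,
          f (xs k) @[k --> \oo] --> f x,
          forall k, regular_subdiff f (xs k) (vs k)
        & vs k @[k --> \oo] --> v]].

Definition indicator (R : realType) (n : nat) (E : set 'rV[R]_n)
    (x : 'rV[R]_n) : \bar R :=
  if x \in E then 0%E else +oo%E.

(* Empty at the points outside E, where the indicator is not finite. *)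
Definition normal_cone (R : realType) (n : nat) (E : set 'rV[R]_n)
    (x : 'rV[R]_n) : set 'rV[R]_n :=
  subdiff (indicator (R := R) E) x.

(* R^n x R is identified with R^(n+1). *)
Definition pt (R : realType) (n : nat) (x : 'rV[R]_n) (t : R) : 'rV[R]_(n + 1) :=
  row_mx x t%:M.

Definition epi (R : realType) (n : nat) (f : 'rV[R]_n -> \bar R) :
    set 'rV[R]_(n + 1) :=
  [set z | (f (lsubmx z) <= (rsubmx z 0 0)%:E)%E].

(* The library's Jacobian acts on row vectors from the right, so the usual
   m x n Jacobian matrix is its transpose. *)
Definition jac (R : realType) (n m : nat) (f : 'rV[R]_n -> 'rV[R]_m)
    (x : 'rV[R]_n) : 'M[R]_(m, n) :=
  (jacobian f x)^T.

Definition C1 (R : realType) (n m : nat) (f : 'rV[R]_n -> 'rV[R]_m) : Prop :=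
  (forall x, differentiable f x) /\ continuous (jac f : 'rV[R]_n -> 'M[R]_(m, n)).

Record problem (R : realType) (n m meq : nat) := Problem {
  objective : 'rV[R]_n -> \bar R;
  ineq : 'rV[R]_n -> 'rV[R]_m;
  eqc : 'rV[R]_n -> 'rV[R]_meq }.

Definition feasible (R : realType) (n m meq : nat) (P : problem R n m meq) :
    set 'rV[R]_n :=
  [set x | (forall i, ineq P x 0 i <= 0) /\ eqc P x = 0].

Definition problem_assumptions (R : realType) (n m meq : nat)
    (P : problem R n m meq) : Prop :=
  [/\ proper_fun (objective P) /\ lower_semicontinuous (objective P),
      C1 (ineq P),
      C1 (eqc P)
    & ereal_inf [set objective P x | x in feasible P] \is a fin_num].

Definition is_KKT (R : realType) (n m meq : nat) (P : problem R n m meq)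
    (ep ed : R) (x : 'rV[R]_n) : Prop :=
  exists (y : 'rV[R]_m) (yeq : 'rV[R]_meq),
    [/\ (dist (- (y *m jac (ineq P) x) - yeq *m jac (eqc P) x)%R
              (subdiff (objective P) x) <= ed%:E)%E,
        `| map_mx (@pos_part R) (ineq P x) | <= ep,
        `| eqc P x | <= ep,
        forall i, 0 <= y 0 i
      & forall i, Num.min (y 0 i) (neg_part (ineq P x 0 i)) <= ep].

Definition infeasibility (R : realType) (n m meq : nat)
    (P : problem R n m meq) (x : 'rV[R]_n) : \bar R :=
  (norm1 (map_mx (@pos_part R) (ineq P x)) + norm1 (eqc P x))%:E.

Definition KKT_feasibility (R : realType) (n m meq : nat)
    (P : problem R n m meq) (x : 'rV[R]_n) : Prop :=
  objective P x \is a fin_num /\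
  [set pt v 0 + w | v in subdiff (infeasibility P) x
                  & w in normal_cone (epi (objective P)) (pt x (fine (objective P x)))] 0.

Definition is_barrier (R : realType) (b : R -> \bar R) : Prop :=
  [/\ proper_fun b,
      lower_semicontinuous b,
      edom b = [set t | t < 0],
      forall t, t < 0 ->
        [/\ derivable (fine \o b) t 1,
            derivable (derive1 (fine \o b)) t 1
          & {for t, continuous (derive1 (derive1 (fine \o b)))}]
    & forall t, t < 0 ->
        0 < derive1 (fine \o b) t /\ 0 < derive1 (derive1 (fine \o b)) t].

Definition conjugate (R : realType) (b : R -> \bar R) (tau : R) : \bar R :=
  ereal_sup [set ((tau * t)%:E - b t)%E | t in [set: R]].

(* The minima defining [psi] and [psi_eq] are written as infima in \bar R, so no
   attainment is presupposed. *)
Definition psi (R : realType) (b : R -> \bar R) (rho t : R) : \bar R :=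
  ereal_inf [set ((rho * z)%:E + b (t - z)%R)%E | z in [set z : R | 0 <= z]].

Definition psi_eq (R : realType) (b : R -> \bar R) (rho t : R) : \bar R :=
  ereal_inf [set ((rho * z)%:E + b (t - z)%R + b (- t - z)%R)%E | z in [set: R]].

Definition penalty_barrier (R : realType) (n m meq : nat) (P : problem R n m meq)
    (b : R -> \bar R) (alpha mu : R) (x : 'rV[R]_n) : \bar R :=
  (objective P x + mu%:E * \sum_(i < m) psi b (alpha / mu)%R (ineq P x 0 i)%R
         + mu%:E * \sum_(j < meq) psi_eq b (alpha / mu)%R (eqc P x 0 j)%R)%E.

Record params (R : realType) := Params {
  eps_p : R;
  eps_d : R;
  alpha0 : R;
  mu0 : R;
  eps0 : R;
  delta_alpha : R;
  delta_eps : R;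
  delta_mu : R }.

Definition params_assumptions (R : realType) (p : params R) : Prop :=
  [/\ 0 <= eps_p p /\ 0 <= eps_d p,
      0 < alpha0 p /\ 0 < mu0 p,
      eps_d p <= eps0 p,
      1 < delta_alpha p
    & 0 < delta_eps p < 1 /\ 0 < delta_mu p < 1].

(* The iterates of a run, as total sequences; when the run stops at iteration k,
   the values at indices larger than k are unconstrained and never referred to
   (see [reached]). *)
Record iterates (R : realType) (n : nat) := Iterates {
  x_ : nat -> 'rV[R]_n;
  eps_ : nat -> R;
  alpha_ : nat -> R;
  mu_ : nat -> R }.

Section Algorithm.
Context (R : realType) (n m meq : nat) (P : problem R n m meq)
  (b : R -> \bar R) (par : params R) (it : iterates R n).

Definition rho_ (k : nat) : R := alpha_ it k / mu_ it k.

Definition y_ (k : nat) : 'rV[R]_m :=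
  \row_i (mu_ it k * derive1 (fine \o psi b (rho_ k)) (ineq P (x_ it k) 0 i)).

Definition yeq_ (k : nat) : 'rV[R]_meq :=
  \row_j (mu_ it k * derive1 (fine \o psi_eq b (rho_ k)) (eqc P (x_ it k) 0 j)).

Definition p_ (k : nat) : R :=
  Num.max `| map_mx (@pos_part R) (ineq P (x_ it k)) | `| eqc P (x_ it k) |.

Definition s_ (k : nat) : R :=
  let y := y_ k in let yeq := yeq_ k in
  let cx := ineq P (x_ it k) in let ceqx := eqc P (x_ it k) in
  let a := alpha_ it k in
  Num.max
    (\big[Num.max/0]_(i < m)
       Num.max `| Num.min (y 0 i) (neg_part (cx 0 i)) |
               `| Num.min (a - y 0 i) (pos_part (cx 0 i)) |)
    (\big[Num.max/0]_(j < meq)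
       Num.max `| Num.min (a + yeq 0 j) (neg_part (ceqx 0 j)) |
               `| Num.min (a - yeq 0 j) (pos_part (ceqx 0 j)) |).

Definition stops (k : nat) : Prop :=
  [/\ eps_ it k <= eps_d par, p_ k <= eps_p par & s_ k <= eps_p par].

Definition reached : set nat := [set k | forall j, (j < k)%N -> ~ stops j].

(* Computed in extended reals, since the conjugate may be +oo. *)
Definition threshold (k : nat) : \bar R :=
  Order.max (eps_p par)%:E
    ((2 * (m + meq)%:R)%:E * (- conjugate b (rho_ k) * ((rho_ k)^-1)%:E))%E.

Record generated : Prop := Generated {
  gen_init :
    [/\ eps_ it 0%N = eps0 par, alpha_ it 0%N = alpha0 par & mu_ it 0%N = mu0 par];
  gen_x : forall k, reached k ->
    (dist 0 (subdiff (penalty_barrier P b (alpha_ it k) (mu_ it k)) (x_ it k))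
      <= (eps_ it k)%:E)%E;
  gen_eps : forall k, reached k.+1 ->
    eps_ it k.+1 = Num.max (delta_eps par * eps_ it k) (eps_d par);
  gen_alpha : forall k, reached k.+1 ->
    alpha_ it k.+1 = if (threshold k < (p_ k)%:E)%E
                     then delta_alpha par * alpha_ it k else alpha_ it k;
  gen_mu : forall k, reached k.+1 ->
    mu_ it k.+1 = if (eps_p par < s_ k) || (alpha_ it k.+1 == alpha_ it k)
                  then delta_mu par * mu_ it k else mu_ it k }.

Definition terminates_KKT : Prop :=
  exists k, [/\ reached k, stops k & is_KKT P (eps_p par) (eps_d par) (x_ it k)].

Definition runs_indefinitely : Prop :=
  [/\ forall k, ~ stops k,
      \forall k \near \oo, s_ k <= eps_p par < p_ k,
      {homo alpha_ it : k l / (k <= l)%N >-> k <= l}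
    & alpha_ it k @[k --> \oo] --> +oo].

End Algorithm.

(* Main.v *)
Require Import Defs.
From HB Require Import structures.
From mathcomp Require Import all_boot all_order all_algebra.
From mathcomp Require Import all_classical all_reals all_analysis.
From mathcomp Require Import ring lra.

Set Implicit Arguments.
Unset Strict Implicit.
Unset Printing Implicit Defensive.

Import Order.TTheory GRing.Theory Num.Theory.
Import numFieldNormedType.Exports.

Local Open Scope classical_set_scope.
Local Open Scope ring_scope.

(** The derivatives of [psi] and [psi_eq] are continuous selections of their
    subgradients: min(b', rho) for [psi], and b'(t - z) - b'(- t - z) for
    [psi_eq], where z is the minimizer.  Hence the penalty is continuously
    differentiable, stationarity of the subproblem reads v - J c^T y -
    J ceq^T yeq \in subdiff q, and the multipliers satisfy complementarity up to
    mu * 2 b'(- eps_p) at points violating it by more than eps_p.  So s_k <= eps_p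
    as soon as mu_k is small.  Since alpha_k / mu_k grows geometrically, the
    threshold of step 7 is eventually eps_p; if mu_k became small, then the
    algorithm would from some point on either stop or increase alpha_k without
    decreasing mu_k.  Hence mu_k is eventually constant and alpha_k grows
    geometrically unless the algorithm stops.

    In that case dividing the stationarity condition by alpha_k gives normals
    (u_k, - 1 / alpha_k) to the epigraph of q at (x_k, q(x_k)).  The scaled
    multipliers y_k / alpha_k stay in the unit box, and their cluster points are
    subgradients of the positive part and of the absolute value at c(xbar) and
    ceq(xbar), because b' is bounded on each half-line left of a negative point
    while alpha_k / mu_k tends to infinity. *)

(** * The barrier *)

Lemma barrier_fin (R : realType) (b : R -> \bar R) (t : R) :
  is_barrier b -> t < 0 -> b t = (fine (b t))%:E.
Proof.
move=> [[bN _] _ bdom _ _] t0; rewrite fineK// fin_numE; apply/andP; split.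
  exact/eqP/bN.
have : edom b t by rewrite bdom.
by rewrite /edom /= ltey.
Qed.

Lemma barrier_pinfty (R : realType) (b : R -> \bar R) (t : R) :
  is_barrier b -> 0 <= t -> b t = +oo%E.
Proof.
move=> [_ _ bdom _ _] t0; apply/eqP; rewrite -leye_eq leNgt; apply/negP => bt.
have : edom b t by [].
by rewrite bdom /= ltNge t0.
Qed.

Lemma barrier_neqNy (R : realType) (b : R -> \bar R) (t : R) :
  is_barrier b -> (b t != -oo)%E.
Proof. by move=> [[bN _] _ _ _ _]; apply/eqP. Qed.

Lemma barrier_derive (R : realType) (b : R -> \bar R) (t : R) :
  is_barrier b -> t < 0 ->
  is_derive t 1 (fine \o b) (derive1 (fine \o b) t).
Proof.
move=> [_ _ _ bd _] t0; have [d1 _ _] := bd t t0.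
by rewrite derive1E; apply: DeriveDef.
Qed.

Lemma barrier_derive_continuous (R : realType) (b : R -> \bar R) (t : R) :
  is_barrier b -> t < 0 -> {for t, continuous (derive1 (fine \o b))}.
Proof.
move=> [_ _ _ bd _] t0; have [_ d2 _] := bd t t0.
by apply: differentiable_continuous; apply/derivable1_diffP.
Qed.

Lemma barrier_continuous (R : realType) (b : R -> \bar R) (t : R) :
  is_barrier b -> t < 0 -> {for t, continuous (fine \o b)}.
Proof.
move=> [_ _ _ bd _] t0; have [d1 _ _] := bd t t0.
by apply: differentiable_continuous; apply/derivable1_diffP.
Qed.

Lemma barrier_derive_lt (R : realType) (b : R -> \bar R) (s t : R) :
  is_barrier b -> s < t -> t < 0 ->
  derive1 (fine \o b) s < derive1 (fine \o b) t.
Proof.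
move=> hb st t0; have [_ _ _ bd bp] := hb.
have lt0 x : x \in `[s, t] -> x < 0.
  by rewrite in_itv/= => /andP[_ xt]; exact: le_lt_trans xt t0.
apply: (@gtr0_derive1_lt_cc _ _ s t) => //; rewrite ?in_itv/= ?lexx ?ltW//.
- move=> x; rewrite in_itv/= => /andP[_ /lt_trans/(_ t0) x0].
  by have [_ d2 _] := bd x x0; exact: d2.
- move=> x; rewrite in_itv/= => /andP[_ /lt_trans/(_ t0) x0].
  by have [_ d2] := bp x x0; exact: d2.
- apply: continuous_in_subspaceT => x; rewrite inE => /lt0.
  exact: barrier_derive_continuous.
Qed.

Lemma barrier_derive_le (R : realType) (b : R -> \bar R) (s t : R) :
  is_barrier b -> s <= t -> t < 0 ->
  derive1 (fine \o b) s <= derive1 (fine \o b) t.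
Proof.
move=> hb; rewrite le_eqVlt => /orP[/eqP->//|st t0].
exact/ltW/barrier_derive_lt.
Qed.

Lemma barrier_derive_gt0 (R : realType) (b : R -> \bar R) (t : R) :
  is_barrier b -> t < 0 -> 0 < derive1 (fine \o b) t.
Proof. by move=> [_ _ _ _ bp] t0; have [] := bp t t0. Qed.

(** The mean value theorem gives a slope [b' c] with [c] strictly between [s] and [t], and the
    monotonicity of [b'] compares it with [b' t]. *)
Lemma barrier_tangent (R : realType) (b : R -> \bar R) (s t : R) :
  is_barrier b -> s < 0 -> t < 0 ->
  fine (b t) + derive1 (fine \o b) t * (s - t) <= fine (b s).
Proof.
move=> hb s0 t0.
have H (u v : R) : u < v -> v < 0 -> exists2 c, u < c < v &
    fine (b v) - fine (b u) = derive1 (fine \o b) c * (v - u).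
  move=> uv v0; have lt0 x : x \in `[u, v] -> x < 0.
    by rewrite in_itv/= => /andP[_ xt]; exact: le_lt_trans xt v0.
  have [x| |c] :=
    @MVT _ (fine \o b) (derive1 (fine \o b)) u v uv.
  - by rewrite in_itv/= => /andP[_ xv]; apply: barrier_derive => //; exact: lt_trans v0.
  - apply: continuous_in_subspaceT => x; rewrite inE => /lt0.
    exact: barrier_continuous.
  - by rewrite in_itv/=; exists c.
have [st|ts|->] := ltgtP s t.
- have [c /andP[sc ct] E] := H s t st t0.
  have := barrier_derive_lt hb ct t0; nra.
- have [c /andP[tc cs] E] := H t s ts s0.
  have c0 := lt_trans cs s0.
  have := barrier_derive_lt hb tc c0; nra.
- by rewrite subrr mulr0 addr0.
Qed.

(** Lower semicontinuity at 0, where [b] is [+oo], makes [b] blow up from the left, whereas a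
    bounded slope would keep it bounded on [-1, 0). *)
Lemma barrier_derive_unbounded (R : realType) (b : R -> \bar R) (M : R) :
  is_barrier b -> exists2 t, t < 0 & M < derive1 (fine \o b) t.
Proof.
move=> hb; apply: contrapT => H.
have {}H t : t < 0 -> derive1 (fine \o b) t <= M.
  by move=> t0; rewrite leNgt; apply/negP => Mt; apply: H; exists t.
have [_ lsc _ _ _] := hb.
have [|V /nbhs_ballP[e /= e0 eV] HV] := lsc 0 (fine (b (-1)) + `|M|).
  by rewrite (barrier_pinfty hb (lexx 0)) ltry.
(* This [t] lies in the neighbourhood of 0 and in [-1, 0), so the tangent at [t], evaluated at -1,
   bounds [b t] by [b (-1) + |M|]. *)
pose t := Num.max (- (e / 2)) (- 1 : R).
have t0 : t < 0 by rewrite /t gt_max; lra.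
have tN1 : -1 <= t by rewrite /t le_max lexx orbT.
have te : - (e / 2) <= t by rewrite /t le_max lexx.
have /HV : V t.
  by apply: eV; rewrite /ball/= sub0r normrN ltr0_norm//; lra.
rewrite (barrier_fin hb t0) lte_fin.
have N1 : -1 < 0 :> R by lra.
have := barrier_tangent hb N1 t0; have := H t t0.
have := barrier_derive_gt0 hb t0.
have := ler_norm M; nra.
Qed.

(** * The smoothed penalties *)

Lemma continuous_of_lipschitz (R : realType) (f : R -> R) :
  (forall s t, f s <= f t + `|s - t|) -> continuous f.
Proof.
move=> H t; apply/cvgrPdist_le => e e0; near=> s.
have H1 := H s t; have H2 := H t s.
have st : `|t - s| <= e by near: s; exact: cvgr_dist_le.
by rewrite distrC in H1; rewrite ler_norml; lra.
Unshelve. all: by end_near. Qed.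

(** The subgradient inequalities at [t] and at [s] place the remainder between 0 and
    [(g s - g t) * (s - t)]. A continuous selection is therefore the derivative, and the minimizers
    in [psi] and [psi_eq] never have to be differentiated. *)
Lemma subgradient_selection_expansion (R : realType) (f g : R -> R) (s t : R) :
  (forall s t, f t + g t * (s - t) <= f s) ->
  `|f s - f t - g t * (s - t)| <= `|g s - g t| * `|s - t|.
Proof.
move=> H; rewrite -normrM.
have H1 := H s t; have H2 := H t s.
by apply: (le_trans _ (ler_norm _)); rewrite ger0_norm; lra.
Qed.

Lemma subgradient_selection_derive (R : realType) (f g : R -> R) (t : R) :
  (forall s t, f t + g t * (s - t) <= f s) -> {for t, continuous g} ->
  derive1 f t = g t.
Proof.
move=> H /continuous_withinNshiftx gc.
apply/cvg_lim => //; apply/cvgrPdist_le => e e0; near=> h.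
have h0 : h != 0 by near: h; exact: nbhs_dnbhs_neq.
have gh : `|g t - g (h + t)| <= e.
  by near: h; move: e e0; apply/cvgrPdist_le.
have -> : g t - h^-1 *: (f (h + t) - f t) =
    - h^-1 * (f (h + t) - f t - g t * (h + t - t)).
  by rewrite /GRing.scale/=; field.
rewrite normrM normrN normfV ler_pdivrMl ?normr_gt0//.
apply: le_trans (subgradient_selection_expansion _ _ H) _.
by rewrite addrK mulrC ler_wpM2l// distrC.
Unshelve. all: by end_near. Qed.

(** Convexity is recorded as the gradient inequality. Together with the continuity of [derive1] it
    also yields differentiability, by [subgradient_selection_expansion]. *)
Definition convex_C1 (R : realType) (p : R -> \bar R) : Prop :=
  [/\ forall t, p t \is a fin_num,
      continuous (derive1 (fine \o p))
    & forall s t, fine (p t) + derive1 (fine \o p) t * (s - t) <= fine (p s)].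

(** The subgradient inequality at [t0] carries finiteness from [t0] to every point. A single finite
    value has to be assumed, because [psi] is [-oo] everywhere when the slopes of [b] stay above a
    number larger than [rho]. *)
Lemma convex_C1_of_selection (R : realType) (p : R -> \bar R) (g : R -> R) (t0 : R) :
  p t0 \is a fin_num -> (forall t, p t < +oo)%E ->
  (forall s t, (p t + (g t * (s - t))%:E <= p s)%E) -> continuous g ->
  convex_C1 p /\ derive1 (fine \o p) = g.
Proof.
move=> pt0 py H gc.
have pfin t : p t \is a fin_num.
  rewrite fin_numElt py andbT.
  by apply: lt_le_trans (H t t0); rewrite -(fineK pt0) -EFinD ltNyr.
have Hf s t : fine (p t) + g t * (s - t) <= fine (p s).
  by rewrite -lee_fin EFinD !fineK.
have dg : derive1 (fine \o p) = g.
  apply/funext => t; apply: subgradient_selection_derive; first exact: Hf.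
  exact: gc.
by rewrite /convex_C1 dg.
Qed.

Lemma psi_le (R : realType) (b : R -> \bar R) (rho t z : R) :
  is_barrier b -> 0 <= z -> t - z < 0 ->
  (psi b rho t <= (rho * z + fine (b (t - z)))%:E)%E.
Proof.
move=> hb z0 tz; apply: ereal_inf_lbound; exists z => //.
by rewrite [in LHS](barrier_fin hb tz).
Qed.

Lemma psi_ge (R : realType) (b : R -> \bar R) (rho t : R) (r : \bar R) :
  is_barrier b ->
  (forall z, 0 <= z -> t - z < 0 -> (r <= (rho * z + fine (b (t - z)))%:E)%E) ->
  (r <= psi b rho t)%E.
Proof.
move=> hb H; apply: le_ereal_inf_tmp => _ [z /= z0 <-].
have [tz|tz] := ltP (t - z) 0; first by rewrite (barrier_fin hb tz); exact: H.
by rewrite (barrier_pinfty hb tz) addey// leey.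
Qed.

(* The selection is min(b', rho), extended by rho to the half-line t >= 0. *)
Lemma psi_subgradient (R : realType) (b : R -> \bar R) (rho : R) :
  is_barrier b -> 0 < rho -> exists g : R -> R,
  [/\ continuous g,
      forall s t, (psi b rho t + (g t * (s - t))%:E <= psi b rho s)%E,
      forall t, 0 <= g t <= rho,
      forall t, 0 <= t -> g t = rho
    & forall t, t < 0 -> g t <= derive1 (fine \o b) t].
Proof.
move=> hb rho0; set db := derive1 (fine \o b).
pose g t := if t < 0 then Num.min (db t) rho else rho.
have g0 t : 0 <= g t <= rho.
  rewrite /g; case: ifPn => t0; last by rewrite ltW//= lexx.
  by rewrite le_min ge_min lexx orbT !ltW//= barrier_derive_gt0.
have [t1 t10 rt1] := barrier_derive_unbounded rho hb.
exists g; split => //.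
(* Since [b'] exceeds [rho] at [t1 < 0], the selection is already constant before 0, so its two
   branches join continuously. *)
- have gT t : t1 <= t -> g t = rho.
    rewrite /g; case: ifPn => // t0 t1t; apply/min_idPr.
    by apply: le_trans (ltW rt1) _; exact: barrier_derive_le.
  move=> t; rewrite /continuous_at.
  have [t0|t0] := ltP t 0; last first.
    have -> : g t = rho by apply: gT; exact: le_trans (ltW t10) t0.
    apply: cvg_near_cst; near=> x; apply: gT; apply: ltW.
    by near: x; apply: lt_nbhsr; exact: lt_le_trans t0.
  have -> : g t = Num.min (db t) rho by rewrite /g t0.
  apply: (@cvg_trans _ (Num.min (db x) rho @[x --> t])).
    apply: near_eq_cvg; near=> x; rewrite /g ifT//.
    by near: x; exact: lt_nbhsl.
  apply: continuous_min; last exact: cvg_cst.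
  exact: barrier_derive_continuous.
- move=> s t; apply: psi_ge => // z z0 sz.
  (* Here [z = 0] is the competitor at [t]: the tangent at [t] handles [s - z], and [rho * z]
     dominates [b' t * z]. *)
  have [/andP[t0 bt]|] := boolP ((t < 0) && (db t <= rho)).
    have -> : g t = db t by rewrite /g t0; apply/min_idPl.
    have tz : t - 0 < 0 by lra.
    apply: le_trans (leeD2r _ (psi_le rho hb (lexx 0) tz)) _.
    rewrite -EFinD lee_fin subr0.
    by have := barrier_tangent hb sz t0; rewrite -/db; nra.
  move=> tN; have -> : g t = rho.
    rewrite /g; case: ifPn => // t0; apply/min_idPr.
    by move: tN; rewrite t0/= -ltNge => /ltW.
  (* If [s - z <= t], the shift [z + t - s] is admissible at [t] and keeps the barrier argument
     [s - z]. Otherwise [t < s - z < 0], and the tangent at [t], of slope above [rho], suffices with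
     [z = 0]. *)
  have [szt|szt] := leP (s - z) t.
    have z1 : 0 <= z + t - s by lra.
    have E : t - (z + t - s) = s - z by ring.
    have tz : t - (z + t - s) < 0 by rewrite E.
    apply: le_trans (leeD2r _ (psi_le rho hb z1 tz)) _.
    by rewrite E -EFinD lee_fin; lra.
  have t0 : t < 0 by lra.
  have tz : t - 0 < 0 by lra.
  move: tN; rewrite t0/= -ltNge => bt.
  apply: le_trans (leeD2r _ (psi_le rho hb (lexx 0) tz)) _.
  rewrite -EFinD lee_fin subr0.
  by have := barrier_tangent hb sz t0; rewrite -/db; nra.
- by move=> t t0; rewrite /g ltNge t0.
- by move=> t t0; rewrite /g t0 ge_min lexx.
Unshelve. all: by end_near. Qed.

Lemma psi_C1 (R : realType) (b : R -> \bar R) (rho t0 : R) :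
  is_barrier b -> 0 < rho -> psi b rho t0 \is a fin_num ->
  let g := derive1 (fine \o psi b rho) in
  [/\ convex_C1 (psi b rho),
      forall t, 0 <= g t <= rho,
      forall t, 0 <= t -> g t = rho
    & forall t, t < 0 -> g t <= derive1 (fine \o b) t].
Proof.
move=> hb rho0 pt0 /=; have [g [gc gs g1 g2 g3]] := psi_subgradient hb rho0.
have [|pC ->] := convex_C1_of_selection pt0 _ gs gc; last by [].
move=> t; have z0 : 0 <= `|t| + 1 by rewrite addr_ge0.
have tz : t - (`|t| + 1) < 0 by have := ler_norm t; lra.
by apply: le_lt_trans (psi_le rho hb z0 tz) _; rewrite ltry.
Qed.

(** * The penalty of an equality constraint *)

Lemma psi_eq_le (R : realType) (b : R -> \bar R) (rho t z : R) :
  is_barrier b -> t - z < 0 -> - t - z < 0 ->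
  (psi_eq b rho t <= (rho * z + fine (b (t - z)%R) + fine (b (- t - z)%R))%:E)%E.
Proof.
move=> hb tz tz'; apply: ereal_inf_lbound; exists z => //.
by rewrite [in LHS](barrier_fin hb tz) [in LHS](barrier_fin hb tz').
Qed.

Lemma psi_eq_ge (R : realType) (b : R -> \bar R) (rho t : R) (r : \bar R) :
  is_barrier b ->
  (forall z, t - z < 0 -> - t - z < 0 ->
    (r <= (rho * z + fine (b (t - z)%R) + fine (b (- t - z)%R))%:E)%E) ->
  (r <= psi_eq b rho t)%E.
Proof.
move=> hb H; apply: le_ereal_inf_tmp => _ [z _ <-].
have [tz|tz] := ltP (t - z) 0; last first.
  by rewrite (barrier_pinfty hb tz) addey// addye ?leey// barrier_neqNy.
have [tz'|tz'] := ltP (- t - z) 0; last first.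
  by rewrite (barrier_pinfty hb tz') (barrier_fin hb tz) addey// leey.
by rewrite (barrier_fin hb tz) (barrier_fin hb tz'); exact: H.
Qed.

(* The minimizing z solves b'(t - z) + b'(- t - z) = rho. It exists as soon as
   b' takes a value below rho / 2, and it is 1-Lipschitz in t because
   z + |s - t| is too large to be the minimizer at s. *)
Lemma psi_eq_minimizer (R : realType) (b : R -> \bar R) (rho a : R) :
  is_barrier b -> a < 0 -> derive1 (fine \o b) a < rho / 2 ->
  exists z : R -> R, [/\ continuous z,
    forall t, t - z t < 0, forall t, - t - z t < 0
    & forall t, derive1 (fine \o b) (t - z t) + derive1 (fine \o b) (- t - z t)
                = rho].
Proof.
move=> hb a0; set db := derive1 (fine \o b) => arho.
have [c c0] := barrier_derive_unbounded rho hb; rewrite -/db => crho.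
have dba : 0 < db a := barrier_derive_gt0 hb a0.
have ac : a < c.
  rewrite ltNge; apply/negP => ca.
  by have := barrier_derive_le hb ca a0; rewrite -/db; lra.
have root (t : R) : exists z, [/\ t - z < 0, - t - z < 0
    & db (t - z) + db (- t - z) = rho].
  have tn := ler_norm t; have tn' := ler_norm (- t); rewrite normrN in tn'.
  have neg z : z \in `[`|t| - c, `|t| - a] -> t - z < 0 /\ - t - z < 0.
    by rewrite in_itv/= => /andP[zc _]; split; lra.
  (* At the left end one of the two arguments equals [c], so the sum exceeds [rho]; at the right end
     both are at most [a], so it is below [rho]. *)
  have [|||z zt E] := @IVT _ (fun z => db (t - z) + db (- t - z))
      (`|t| - c) (`|t| - a) rho; first by lra.
  - apply: continuous_in_subspaceT => z; rewrite inE => /neg[z1 z2].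
    apply: cvgD; apply: continuous_comp; try exact: barrier_derive_continuous.
      by apply: cvgB; [exact: cvg_cst|exact: cvg_id].
    by apply: cvgB; [exact: cvg_cst|exact: cvg_id].
  - rewrite ge_min le_max; apply/andP; split; apply/orP; [right|left].
      have h1 := @barrier_derive_le _ b (t - (`|t| - a)) a hb.
      have h2 := @barrier_derive_le _ b (- t - (`|t| - a)) a hb.
      by have := h1 ltac:(lra) a0; have := h2 ltac:(lra) a0; rewrite -/db; lra.
    have p1 : 0 < db (t - (`|t| - c)) by apply: barrier_derive_gt0 => //; lra.
    have p2 : 0 < db (- t - (`|t| - c)) by apply: barrier_derive_gt0 => //; lra.
    have [t0|t0] := leP 0 t.
      have E : t - (`|t| - c) = c by rewrite ger0_norm//; ring.
      by rewrite E in p1 *; lra.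
    have E : - t - (`|t| - c) = c by rewrite ltr0_norm//; ring.
    by rewrite E in p2 *; lra.
  - by exists z; have [] := neg _ zt.
have [z zP] := choice root; exists z; split; try by move=> t; have [] := zP t.
apply: continuous_of_lipschitz => s t.
rewrite leNgt; apply/negP => zst.
have [t1 t2 tE] := zP t; have [s1 s2 sE] := zP s.
have st1 := ler_norm (s - t); have st2 := ler_norm (t - s).
rewrite distrC in st2.
have := @barrier_derive_lt _ b (s - z s) (t - z t) hb ltac:(lra) t1.
have := @barrier_derive_lt _ b (- s - z s) (- t - z t) hb ltac:(lra) t2.
by rewrite -/db; lra.
Qed.

(** With a minimizer [z], the equation [b'(t - z) + b'(- t - z) = rho] turns [rho - g t] into
    [2 b'(- t - z)] and [rho + g t] into [2 b'(t - z)]. Both final bounds then follow from [z > |t|]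
    and the monotonicity of [b']. *)
Lemma psi_eq_subgradient (R : realType) (b : R -> \bar R) (rho : R) :
  is_barrier b -> 0 < rho -> exists g : R -> R,
  [/\ continuous g,
      forall s t, (psi_eq b rho t + (g t * (s - t))%:E <= psi_eq b rho s)%E,
      forall t, `|g t| <= rho,
      forall t, 0 < t -> rho - g t <= 2 * derive1 (fine \o b) (- t)
    & forall t, t < 0 -> rho + g t <= 2 * derive1 (fine \o b) t].
Proof.
move=> hb rho0; set db := derive1 (fine \o b).
have [[a [a0 arho]]|nd] :=
    pselect (exists a, a < 0 /\ derive1 (fine \o b) a < rho / 2).
  have [z [zc z1 z2 zE]] := psi_eq_minimizer hb a0 arho.
  rewrite -/db in zE.
  have p1 t := barrier_derive_gt0 hb (z1 t).
  have p2 t := barrier_derive_gt0 hb (z2 t).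
  rewrite -/db in p1 p2.
  exists (fun t => db (t - z t) - db (- t - z t)); split.
  - move=> t; apply: cvgB.
      apply: (continuous_comp (f := fun t => t - z t)).
        by apply: cvgB; [exact: cvg_id|exact: zc].
      exact: barrier_derive_continuous.
    apply: (continuous_comp (f := fun t => - t - z t)).
      by apply: cvgB; [apply: cvgN; exact: cvg_id|exact: zc].
    exact: barrier_derive_continuous.
  - move=> s t; apply: psi_eq_ge => // w w1 w2.
    apply: le_trans (leeD2r _ (psi_eq_le rho hb (z1 t) (z2 t))) _.
    rewrite -EFinD lee_fin.
    (* In the sum of the two tangent inequalities the coefficient of [w] is [- rho] by the choice of
       [z], which cancels the cost [rho * w]. *)
    have := barrier_tangent hb w1 (z1 t); have := barrier_tangent hb w2 (z2 t).
    by rewrite -/db; have := zE t; nra.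
  - by move=> t; rewrite ler_norml; have := zE t; have := p1 t; have := p2 t; lra.
  - move=> t t0; have := zE t; have := z1 t => z1t.
    have := @barrier_derive_le _ b (- t - z t) (- t) hb ltac:(lra) ltac:(lra).
    by rewrite -/db; lra.
  - move=> t t0; have := zE t; have := z2 t => z2t.
    have := @barrier_derive_le _ b (t - z t) t hb ltac:(lra) ltac:(lra).
    by rewrite -/db; lra.
(* In this degenerate case the infimum is approached as z tends to +oo, and
   psi_eq is constant. *)
have {}nd t : t < 0 -> rho <= 2 * db t.
  move=> t0; rewrite leNgt; apply/negP => H; apply: nd; exists t; split => //.
  by rewrite -/db; lra.
exists (fun=> 0); split.
- exact: cst_continuous.
- move=> s t; rewrite mul0r adde0; apply: psi_eq_ge => // w w1 w2.
  have st1 := ler_norm (s - t); have st2 := ler_norm (t - s).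
  rewrite distrC in st2.
  (* Raising [w] by [|s - t|] costs [rho * |s - t|]. It lowers the two arguments by [2 * |s - t|] in
     total, and slopes of at least [rho / 2] repay the cost. *)
  have z1 : t - (w + `|s - t|) < 0 by lra.
  have z2 : - t - (w + `|s - t|) < 0 by lra.
  apply: le_trans (psi_eq_le rho hb z1 z2) _; rewrite lee_fin.
  have := barrier_tangent hb w1 z1; have := barrier_tangent hb w2 z2.
  have := nd _ z1; have := nd _ z2; rewrite -/db; nra.
- by move=> t; rewrite normr0 ltW.
- by move=> t t0; rewrite subr0; apply: nd; lra.
- by move=> t t0; rewrite addr0; apply: nd.
Qed.

Lemma psi_eq_C1 (R : realType) (b : R -> \bar R) (rho t0 : R) :
  is_barrier b -> 0 < rho -> psi_eq b rho t0 \is a fin_num ->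
  let g := derive1 (fine \o psi_eq b rho) in
  [/\ convex_C1 (psi_eq b rho),
      forall t, `|g t| <= rho,
      forall t, 0 < t -> rho - g t <= 2 * derive1 (fine \o b) (- t)
    & forall t, t < 0 -> rho + g t <= 2 * derive1 (fine \o b) t].
Proof.
move=> hb rho0 pt0 /=; have [g [gc gs g1 g2 g3]] := psi_eq_subgradient hb rho0.
have [|pC ->] := convex_C1_of_selection pt0 _ gs gc; last by [].
move=> t; have := ler_norm t; have := ler_norm (- t); rewrite normrN => h1 h2.
have z1 : t - (`|t| + 1) < 0 by lra.
have z2 : - t - (`|t| + 1) < 0 by lra.
by apply: le_lt_trans (psi_eq_le rho hb z1 z2) _; rewrite ltry.
Qed.

(** * First-order expansions and the sum rule *)

Lemma norm2_ge0 (R : realType) (n : nat) (u : 'rV[R]_n) : 0 <= norm2 u.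
Proof. exact: sqrtr_ge0. Qed.

Lemma norm2N (R : realType) (n : nat) (u : 'rV[R]_n) : norm2 (- u) = norm2 u.
Proof.
by congr Num.sqrt; apply: eq_bigr => i _; rewrite !mxE mulrNN.
Qed.

Lemma ler_coord_norm2 (R : realType) (n : nat) (u : 'rV[R]_n) (i : 'I_n) :
  `|u 0 i| <= norm2 u.
Proof.
rewrite -sqrtr_sqr ler_wsqrtr// /dot (bigD1 i)//= -expr2 lerDl.
by apply: sumr_ge0 => j _; rewrite -expr2 sqr_ge0.
Qed.

Lemma mx_norm_le (R : realType) (m n : nat) (u : 'M[R]_(m, n)) (e : R) :
  0 <= e -> (forall i j, `|u i j| <= e) -> `|u| <= e.
Proof.
move=> e0 H; rewrite [leLHS]/Num.norm/= mx_normrE; by apply: bigmax_le.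
Qed.

Lemma ler_coord_mx_norm (R : realType) (m n : nat) (u : 'M[R]_(m, n)) i j :
  `|u i j| <= `|u|.
Proof.
rewrite [leRHS]/Num.norm/= mx_normrE.
exact: (@le_bigmax _ _ _ _ (fun k => `|u k.1 k.2|) (i, j)).
Qed.

Lemma mx_norm_le_norm2 (R : realType) (n : nat) (u : 'rV[R]_n) : `|u| <= norm2 u.
Proof.
apply: mx_norm_le; first exact: norm2_ge0.
by move=> i j; rewrite ord1; exact: ler_coord_norm2.
Qed.

Lemma ler_dot (R : realType) (n : nat) (u v : 'rV[R]_n) :
  `|dot u v| <= norm1 u * norm2 v.
Proof.
apply: le_trans (ler_norm_sum _ _ _) _; rewrite mulr_suml.
by apply: ler_sum => i _; rewrite normrM ler_wpM2l// ler_coord_norm2.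
Qed.

Lemma norm1_ge0 (R : realType) (n : nat) (u : 'rV[R]_n) : 0 <= norm1 u.
Proof. by apply: sumr_ge0. Qed.

Lemma dotDl (R : realType) (n : nat) (u v w : 'rV[R]_n) :
  dot (u + v) w = dot u w + dot v w.
Proof. by rewrite -big_split; apply: eq_bigr => i _; rewrite mxE mulrDl. Qed.

Lemma dotZl (R : realType) (n : nat) a (u w : 'rV[R]_n) :
  dot (a *: u) w = a * dot u w.
Proof. by rewrite mulr_sumr; apply: eq_bigr => i _; rewrite mxE mulrA. Qed.

Lemma dotBl (R : realType) (n : nat) (u v w : 'rV[R]_n) :
  dot (u - v) w = dot u w - dot v w.
Proof. by rewrite -scaleN1r dotDl dotZl mulN1r. Qed.

Lemma dot0l (R : realType) (n : nat) (w : 'rV[R]_n) : dot 0 w = 0.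
Proof. by apply: big1 => i _; rewrite mxE mul0r. Qed.

Lemma cvg_mx (R : realType) (T : Type) (F : set_system T) {FF : Filter F} (m n : nat)
    (f : T -> 'M[R]_(m, n)) (l : 'M[R]_(m, n)) :
  (forall i j, f x i j @[x --> F] --> l i j) -> f @ F --> l.
Proof.
move=> H; apply/cvgrPdist_le => e e0.
have : \forall x \near F, forall ij : 'I_m * 'I_n, `|l ij.1 ij.2 - f x ij.1 ij.2| <= e.
  apply: filter_forall => -[i j] /=.
  by move: e e0; apply/cvgrPdist_le; exact: H.
apply: filterS => x Hx; apply: mx_norm_le; first exact: ltW.
by move=> i j; rewrite !mxE; exact: Hx (i, j).
Qed.

Lemma cvg_coord (R : realType) (T : Type) (F : set_system T) {FF : Filter F} (m n : nat)
    (f : T -> 'M[R]_(m, n)) (l : 'M[R]_(m, n)) i j :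
  f @ F --> l -> f x i j @[x --> F] --> l i j.
Proof.
move=> fl.
exact: (@cvg_comp _ _ _ f (fun M => M i j) F (nbhs l) _ fl
  (@coord_continuous _ m n i j l)).
Qed.

Lemma cvg_row (R : realType) (T : Type) (F : set_system T) {FF : Filter F} (m n : nat)
    (f : T -> 'M[R]_(m, n)) (l : 'M[R]_(m, n)) i :
  f @ F --> l -> row i (f x) @[x --> F] --> row i l.
Proof.
move=> fl; apply: (@cvg_mx R T F FF) => k j; rewrite mxE.
have -> : (fun x => row i (f x) k j) = (fun x => f x i j).
  by apply/funext => x; rewrite mxE.
exact: cvg_coord.
Qed.

(** * Calculus of gradients *)

Definition has_gradient (R : realType) (n : nat) (f : 'rV[R]_n -> R)
    (x v : 'rV[R]_n) : Prop :=
  forall e, 0 < e -> \forall y \near x,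
    `|f y - f x - dot v (y - x)| <= e * norm2 (y - x).

(** The expansion is measured in [norm2], as in [regular_subdiff], so that gradients can be
    subtracted directly from regular subgradients. *)
Definition smooth (R : realType) (n : nat) (f : 'rV[R]_n -> R)
    (G : 'rV[R]_n -> 'rV[R]_n) : Prop :=
  [/\ continuous f, continuous G & forall x, has_gradient f x (G x)].

Lemma smooth0 (R : realType) (n : nat) : @smooth R n (fun=> 0) (fun=> 0).
Proof.
split; [exact: cst_continuous|exact: cst_continuous|move=> x e e0].
near=> y; rewrite dot0l !subr0 normr0.
by rewrite mulr_ge0 ?norm2_ge0// ltW.
Unshelve. all: by end_near. Qed.

Lemma smoothD (R : realType) (n : nat) (f g : 'rV[R]_n -> R)
    (F G : 'rV[R]_n -> 'rV[R]_n) :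
  smooth f F -> smooth g G -> smooth (fun x => f x + g x) (fun x => F x + G x).
Proof.
move=> [fc Fc fF] [gc Gc gG]; split.
- by move=> x; exact: (cvgD (fc x) (gc x)).
- by move=> x; exact: (cvgD (Fc x) (Gc x)).
move=> x e e0; have e20 : 0 < e / 2 by lra.
have := fF x _ e20; have := gG x _ e20.
apply: filterS2 => y; rewrite dotDl => H1 H2.
have -> : f y + g y - (f x + g x) - (dot (F x) (y - x) + dot (G x) (y - x)) =
  (f y - f x - dot (F x) (y - x)) + (g y - g x - dot (G x) (y - x)) by ring.
by apply: le_trans (ler_normD _ _) _; lra.
Qed.

Lemma smooth_scale (R : realType) (n : nat) (a : R) (f : 'rV[R]_n -> R)
    (F : 'rV[R]_n -> 'rV[R]_n) :
  smooth f F -> smooth (fun x => a * f x) (fun x => a *: F x).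
Proof.
move=> [fc Fc fF]; split.
- by move=> x; exact: (cvgM (cvg_cst a) (fc x)).
- by move=> x; exact: (cvgZ (cvg_cst a) (Fc x)).
move=> x e e0.
have a0 : 0 < `|a| + 1 by rewrite ltr_wpDl.
have := fF x _ (divr_gt0 e0 a0); apply: filterS => y H.
rewrite dotZl -!mulrBr normrM.
apply: le_trans (ler_wpM2l (normr_ge0 a) H) _.
rewrite mulrA ler_wpM2r ?norm2_ge0// mulrA ler_pdivrMr// mulrC.
by rewrite ler_wpM2l ?ltW// ltrDl.
Qed.

Lemma smooth_sum (R : realType) (n m : nat) (f : 'I_m -> 'rV[R]_n -> R)
    (F : 'I_m -> 'rV[R]_n -> 'rV[R]_n) :
  (forall i, smooth (f i) (F i)) ->
  smooth (fun x => \sum_i f i x) (fun x => \sum_i F i x).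
Proof.
move=> H; elim: (index_enum _) => [|i r IH].
  have -> : (fun x => \sum_(i <- [::]) f i x) = (fun=> 0).
    by apply/funext => x; rewrite big_nil.
  have -> : (fun x => \sum_(i <- [::]) F i x) = (fun=> 0).
    by apply/funext => x; rewrite big_nil.
  exact: smooth0.
have -> : (fun x => \sum_(j <- i :: r) f j x) =
          (fun x => f i x + \sum_(j <- r) f j x).
  by apply/funext => x; rewrite big_cons.
have -> : (fun x => \sum_(j <- i :: r) F j x) =
          (fun x => F i x + \sum_(j <- r) F j x).
  by apply/funext => x; rewrite big_cons.
exact: smoothD.
Qed.

Lemma has_gradient_increment (R : realType) (n : nat) (f : 'rV[R]_n -> R)
    (x v : 'rV[R]_n) :
  has_gradient f x v ->
  \forall y \near x, `|f y - f x| <= (norm1 v + 1) * norm2 (y - x).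
Proof.
move=> /(_ 1 ltr01); apply: filterS => y H.
have -> : f y - f x = (f y - f x - dot v (y - x)) + dot v (y - x) by ring.
by apply: le_trans (ler_normD _ _) _; have := ler_dot v (y - x); lra.
Qed.

(** Chain rule: the remainder is the outer remainder, at most [|g (f y) - g (f x)| * |f y - f x|],
    plus [g (f x)] times the inner remainder. Each is kept below half of [e * norm2 (y - x)]. *)
Lemma smooth_comp (R : realType) (n : nat) (p : R -> \bar R)
    (f : 'rV[R]_n -> R) (F : 'rV[R]_n -> 'rV[R]_n) :
  convex_C1 p -> smooth f F ->
  smooth (fun x => fine (p (f x)))
         (fun x => derive1 (fine \o p) (f x) *: F x).
Proof.
move=> [_ gc ps] [fc Fc fF]; set g := derive1 _ in gc ps *.
have pT s t := subgradient_selection_expansion (f := fine \o p) s t ps.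
have gcf x : g (f y) @[y --> x] --> g (f x).
  by apply: (continuous_comp (f := f)); [exact: fc|exact: gc].
split.
- move=> x; apply: (continuous_comp (f := f) (g := fine \o p)); first exact: fc.
  set t := f x; apply/cvgrPdist_le => e e0; near=> s.
  have K0 : 0 < `|g t| + 1 by rewrite ltr_wpDl.
  have gs : `|g t - g s| <= 1.
    by near: s; move: (gc t) => /cvgrPdist_le; apply.
  have st : `|t - s| <= e / (`|g t| + 1).
    by near: s; apply: cvgr_dist_le => //; exact: divr_gt0.
  have {}st : `|t - s| * (`|g t| + 1) <= e by rewrite -ler_pdivlMr.
  have := pT s t; rewrite [`|g s - g t|]distrC [`|s - t|]distrC => H.
  have -> : fine (p t) - fine (p s) =
      - (fine (p s) - fine (p t) - g t * (s - t)) - g t * (s - t) by ring.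
  apply: le_trans (ler_normB _ _) _; rewrite normrN normrM [`|s - t|]distrC.
  apply: le_trans (lerD H (lexx _)) _.
  by have := normr_ge0 (t - s); nra.
- by move=> x; exact: (cvgZ (gcf x) (Fc x)).
move=> x e e0.
have L0 : 0 < norm1 (F x) + 1 by rewrite ltr_wpDl// norm1_ge0.
have K0 : 0 < `|g (f x)| + 1 by rewrite ltr_wpDl.
have e1 : 0 < e / 2 / (norm1 (F x) + 1) by rewrite !divr_gt0.
have e2 : 0 < e / 2 / (`|g (f x)| + 1) by rewrite !divr_gt0.
near=> y.
have H1 : `|f y - f x| <= (norm1 (F x) + 1) * norm2 (y - x).
  by near: y; apply: has_gradient_increment; exact: fF.
have H2 : `|g (f x) - g (f y)| <= e / 2 / (norm1 (F x) + 1).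
  by near: y; move: (gcf x) => /cvgrPdist_le; apply.
have H3 : `|f y - f x - dot (F x) (y - x)| <=
    e / 2 / (`|g (f x)| + 1) * norm2 (y - x).
  by near: y; apply: fF.
rewrite dotZl.
have -> : fine (p (f y)) - fine (p (f x)) - g (f x) * dot (F x) (y - x) =
   (fine (p (f y)) - fine (p (f x)) - g (f x) * (f y - f x)) +
   g (f x) * (f y - f x - dot (F x) (y - x)) by ring.
apply: le_trans (ler_normD _ _) _.
have N0 := norm2_ge0 (y - x).
have -> : e * norm2 (y - x) = e / 2 * norm2 (y - x) + e / 2 * norm2 (y - x).
  by field.
apply: lerD.
  apply: le_trans (pT _ _) _; rewrite distrC.
  apply: le_trans (ler_pM _ _ H2 H1) _ => //.
  by rewrite mulrA divfK// gt_eqF.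
rewrite normrM; apply: le_trans (ler_wpM2l (normr_ge0 _) H3) _.
rewrite mulrA ler_wpM2r// mulrA ler_pdivrMr// mulrC ler_wpM2l//; first lra.
by rewrite lerDl.
Unshelve. all: by end_near. Qed.

Lemma differentiable_expansion (R : realType) (n m : nat)
    (c : 'rV[R]_n -> 'rV[R]_m) (x : 'rV[R]_n) (e : R) :
  0 < e -> differentiable c x ->
  \forall y \near x, `|c y - c x - 'd c x (y - x)| <= e * `|y - x|.
Proof.
move=> e0 cd.
have [_] := (diff_locallyxP x c).1 cd; set o := the_littleo _ _ _ _ _ => H.
have : \forall h \near (0 : 'rV[R]_n), `|c (h + x) - c x - 'd c x h| <= e * `|h|.
  have /eqoP/(_ e e0) := littleo_eqo o.
  apply: filterS => h; rewrite H.
  by rewrite -(addrA _ (- c x)) -opprD addrAC subrr add0r.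
rewrite (near_shift (0 : 'rV[R]_n) x); apply: filterS => h /=.
by rewrite subr0 addrK.
Qed.

Lemma smooth_coord (R : realType) (n m : nat) (c : 'rV[R]_n -> 'rV[R]_m) (i : 'I_m) :
  C1 c -> smooth (fun x => c x 0 i) (fun x => row i (jac c x)).
Proof.
move=> [cd cj]; split.
- move=> x; exact: (cvg_coord (differentiable_continuous (cd x))).
- by move=> x; exact: (cvg_row (cj x)).
move=> x e e0; near=> y.
have H : `|c y - c x - 'd c x (y - x)| <= e * `|y - x|.
  by near: y; exact: differentiable_expansion.
have -> : dot (row i (jac c x)) (y - x) = ('d c x (y - x)) 0 i.
  rewrite -(mul_rV_lin1 ('d c x)) mxE; apply: eq_bigr => k _.
  by rewrite !mxE mulrC.
have := ler_coord_mx_norm (c y - c x - 'd c x (y - x)) 0 i.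
rewrite !mxE => /le_trans; apply; apply: le_trans H _.
by apply: ler_wpM2l; [exact: ltW|exact: mx_norm_le_norm2].
Unshelve. all: by end_near. Qed.

(** Subtracting [G (xs k)] turns the regular subgradients of the sum along the defining sequence
    into regular subgradients of [q]. Continuity of [f] gives the convergence of the values of [q],
    continuity of [G] that of the subgradients. *)
Lemma subdiff_sub_smooth (R : realType) (n : nat) (q : 'rV[R]_n -> \bar R)
    (f : 'rV[R]_n -> R) (G : 'rV[R]_n -> 'rV[R]_n) (x v : 'rV[R]_n) :
  smooth f G -> (forall x, q x <> -oo%E) ->
  subdiff (fun x => (q x + (f x)%:E)%E) x v -> subdiff q x (v - G x).
Proof.
move=> [fc Gc fG] qN [Fx [xs [vs [xsx Fxs vsr vsv]]]].
have qfin y : (q y + (f y)%:E)%E \is a fin_num -> q y \is a fin_num.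
  by rewrite fin_numD => /andP[].
have qx := qfin _ Fx; split => //.
exists xs, (fun k => vs k - G (xs k)); split => //.
- have fx : (f (xs k))%:E @[k --> \oo] --> (f x)%:E.
    by apply: cvg_EFin; [exact: nearW|apply: (cvg_comp _ _ xsx); exact: fc].
  have -> : (fun k => q (xs k)) = (fun k => q (xs k) + (f (xs k))%:E - (f (xs k))%:E)%E.
    by apply/funext => k; rewrite addeK.
  have -> : q x = (q x + (f x)%:E - (f x)%:E)%E by rewrite addeK.
  by apply: cvgeB => //; rewrite fin_num_adde_defl.
- move=> k; have [Fk vk] := vsr k; split; first exact: qfin.
  move=> e e0; have e20 : 0 < e / 2 by lra.
  have := vk _ e20; have := fG (xs k) _ e20.
  apply: filterS2 => y H1 H2.
  have [qy|qy] := boolP (q y \is a fin_num); last first.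
    suff -> : q y = +oo%E by rewrite leey.
    by move: qy (qN y); case: (q y).
  move: (qfin _ Fk) qy H2.
  case: (q (xs k)) => // r _; case: (q y) => // s _.
  rewrite -!EFinD !lee_fin dotBl => H2.
  by move: H1; rewrite ler_norml; lra.
- by apply: cvgB => //; apply: (cvg_comp _ _ xsx); exact: Gc.
Qed.

(** * Normal cones to epigraphs *)

Definition has_subgradient (R : realType) (n : nat) (f : 'rV[R]_n -> R)
    (x v : 'rV[R]_n) : Prop :=
  forall e, 0 < e -> \forall y \near x,
    f x + dot v (y - x) - e * norm2 (y - x) <= f y.

Lemma has_subgradient0 (R : realType) (n : nat) (x : 'rV[R]_n) :
  has_subgradient (fun=> 0) x 0.
Proof.
move=> e e0; near=> y; rewrite dot0l addr0 sub0r oppr_le0.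
by rewrite mulr_ge0 ?norm2_ge0// ltW.
Unshelve. all: by end_near. Qed.

Lemma has_subgradientD (R : realType) (n : nat) (f g : 'rV[R]_n -> R)
    (x v w : 'rV[R]_n) :
  has_subgradient f x v -> has_subgradient g x w ->
  has_subgradient (fun x => f x + g x) x (v + w).
Proof.
move=> fv gw e e0; have e20 : 0 < e / 2 by lra.
have := fv _ e20; have := gw _ e20; apply: filterS2 => y.
by rewrite dotDl; lra.
Qed.

Lemma has_subgradient_sum (R : realType) (n m : nat) (f : 'I_m -> 'rV[R]_n -> R)
    (x : 'rV[R]_n) (v : 'I_m -> 'rV[R]_n) :
  (forall i, has_subgradient (f i) x (v i)) ->
  has_subgradient (fun x => \sum_i f i x) x (\sum_i v i).
Proof.
move=> H; elim: (index_enum _) => [|i r IH].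
  have -> : (fun x => \sum_(i <- [::]) f i x) = (fun=> 0).
    by apply/funext => y; rewrite big_nil.
  by rewrite big_nil; exact: has_subgradient0.
have -> : (fun x => \sum_(j <- i :: r) f j x) =
          (fun x => f i x + \sum_(j <- r) f j x).
  by apply/funext => y; rewrite big_cons.
by rewrite big_cons; exact: has_subgradientD.
Qed.

(** The global affine minorant of [phi] at [f x] is evaluated at [f y]; the expansion of [f] then
    costs an error of [|a|] times a small multiple of [norm2 (y - x)]. *)
Lemma has_subgradient_comp (R : realType) (n : nat) (phi : R -> R)
    (f : 'rV[R]_n -> R) (x v : 'rV[R]_n) (a : R) :
  has_gradient f x v -> (forall s, phi (f x) + a * (s - f x) <= phi s) ->
  has_subgradient (fun x => phi (f x)) x (a *: v).
Proof.
move=> fv ha e e0; have a0 : 0 < `|a| + 1 by rewrite ltr_wpDl.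
have := fv _ (divr_gt0 e0 a0); apply: filterS => y H.
apply: le_trans (ha (f y)); rewrite dotZl -addrA lerD2l.
rewrite lerBlDr -lerBlDl -mulrBr.
apply: le_trans (ler_norm _) _; rewrite normrM distrC.
apply: le_trans (ler_wpM2l (normr_ge0 a) H) _.
rewrite mulrA ler_wpM2r ?norm2_ge0// mulrA ler_pdivrMr// mulrC.
by apply: ler_wpM2l; [exact: ltW|rewrite lerDl].
Qed.

Lemma subdiff_of_has_subgradient (R : realType) (n : nat) (f : 'rV[R]_n -> R)
    (x v : 'rV[R]_n) :
  has_subgradient f x v -> subdiff (fun x => (f x)%:E) x v.
Proof.
move=> fv; split => //; exists (fun=> x), (fun=> v); split.
- exact: cvg_cst.
- exact: cvg_cst.
- move=> _; split => // e e0; have := fv _ e0; apply: filterS => y.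
  by rewrite -EFinD lee_fin addrA.
- exact: cvg_cst.
Qed.

(** Each summand is a convex function of one smooth coordinate, so subgradients of the positive part
    and of the absolute value pull back through the Jacobian rows. The result is already a regular
    subgradient, and constant sequences put it in [subdiff]. *)
Lemma infeasibility_subdiff (R : realType) (n m meq : nat) (P : problem R n m meq)
    (x : 'rV[R]_n) (y : 'rV[R]_m) (yeq : 'rV[R]_meq) :
  C1 (ineq P) -> C1 (eqc P) ->
  (forall i s, pos_part (ineq P x 0 i) + y 0 i * (s - ineq P x 0 i) <= pos_part s) ->
  (forall j s, `|eqc P x 0 j| + yeq 0 j * (s - eqc P x 0 j) <= `|s|) ->
  subdiff (infeasibility P) x (y *m jac (ineq P) x + yeq *m jac (eqc P) x).
Proof.
move=> cC ceqC hy hyeq; rewrite /infeasibility.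
apply: (@subdiff_of_has_subgradient R n (fun x =>
  norm1 (map_mx (@pos_part R) (ineq P x)) + norm1 (eqc P x))).
rewrite !mulmx_sum_row; apply: has_subgradientD.
  have -> : (fun x => norm1 (map_mx (@pos_part R) (ineq P x))) =
      (fun x => \sum_i pos_part (ineq P x 0 i)).
    apply/funext => z; apply: eq_bigr => i _; rewrite mxE ger0_norm//.
    by rewrite le_max lexx.
  apply: has_subgradient_sum => i.
  apply: (has_subgradient_comp (phi := @pos_part R)); last exact: hy.
  by have [_ _] := smooth_coord i cC; apply.
apply: has_subgradient_sum => j.
apply: (has_subgradient_comp (phi := fun s => `|s|)); last exact: hyeq.
by have [_ _] := smooth_coord j ceqC; apply.
Qed.

(** * The product space and the epigraph *)

Lemma dot_pt (R : realType) (n : nat) (u v : 'rV[R]_n) (s t : R) :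
  dot (pt u s) (pt v t) = dot u v + s * t.
Proof.
rewrite /dot big_split_ord/= big_ord1 !row_mxEr !mxE eqxx !mulr1n; congr (_ + _).
by apply: eq_bigr => i _; rewrite !row_mxEl.
Qed.

Lemma norm2_pt (R : realType) (n : nat) (u : 'rV[R]_n) (t : R) :
  norm2 u <= norm2 (pt u t).
Proof. by rewrite ler_wsqrtr// dot_pt lerDl -expr2 sqr_ge0. Qed.

Lemma ptB (R : realType) (n : nat) (u v : 'rV[R]_n) (s t : R) :
  pt u s - pt v t = pt (u - v) (s - t).
Proof. by rewrite /pt opp_row_mx add_row_mx -raddfB. Qed.

Lemma ptD (R : realType) (n : nat) (u v : 'rV[R]_n) (s t : R) :
  pt u s + pt v t = pt (u + v) (s + t).
Proof. by rewrite /pt add_row_mx -raddfD. Qed.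

Lemma pt_submx (R : realType) (n : nat) (z : 'rV[R]_(n + 1)) :
  z = pt (lsubmx z) (rsubmx z 0 0).
Proof. by rewrite /pt -mx11_scalar hsubmxK. Qed.

Lemma epi_pt (R : realType) (n : nat) (q : 'rV[R]_n -> \bar R) (x : 'rV[R]_n) (t : R) :
  epi q (pt x t) <-> (q x <= t%:E)%E.
Proof. by rewrite /epi/= row_mxKl row_mxKr mxE eqxx mulr1n. Qed.

Lemma cvg_pt (R : realType) (n : nat) (T : Type) (F : set_system T) {FF : Filter F}
    (u : T -> 'rV[R]_n) (s : T -> R) (x : 'rV[R]_n) (t : R) :
  u @ F --> x -> s @ F --> t -> pt (u k) (s k) @[k --> F] --> pt x t.
Proof.
move=> ux st; apply: (@cvg_mx R T F FF) => i j.
have [k ->|k ->] := split_ordP j.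
  rewrite row_mxEl; have -> : (fun y => pt (u y) (s y) i (lshift 1 k)) =
    (fun y => u y i k) by apply/funext => y; rewrite row_mxEl.
  exact: cvg_coord.
rewrite row_mxEr !ord1 mxE eqxx mulr1n.
have -> // : (fun y => pt (u y) (s y) 0 (rshift n 0)) = s.
by apply/funext => y; rewrite row_mxEr mxE eqxx mulr1n.
Qed.

Lemma cvg_lsubmx (R : realType) (n p : nat) (z : 'rV[R]_(n + p)) :
  lsubmx y @[y --> z] --> (lsubmx z : 'rV[R]_n).
Proof.
apply: (@cvg_mx R _ (nbhs z) _ 1 n (fun y => lsubmx y)) => i j; rewrite mxE.
have -> : (fun y : 'rV[R]_(n + p) => lsubmx y i j) = (fun y => y i (lshift p j)).
  by apply/funext => y; rewrite mxE.
exact: coord_continuous.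
Qed.

Lemma indicator_mem (R : realType) (n : nat) (E : set 'rV[R]_n) x :
  E x -> @indicator R n E x = 0%E.
Proof. by move=> Ex; rewrite /indicator mem_set. Qed.

Lemma indicator_fin (R : realType) (n : nat) (E : set 'rV[R]_n) x :
  @indicator R n E x \is a fin_num -> E x.
Proof. by rewrite /indicator; case: ifPn => // /set_mem. Qed.

(* Multiplying by l > 0 keeps the normal vector finite as l tends to 0, which is
   how a subgradient sequence of unbounded size passes to the limit. *)
Lemma subdiff_epi_normal (R : realType) (n : nat) (q : 'rV[R]_n -> \bar R)
    (x v : 'rV[R]_n) (l : R) :
  0 < l -> subdiff q x v ->
  normal_cone (epi q) (pt x (fine (q x))) (pt (l *: v) (- l)).
Proof.
move=> l0 [qx [xs [vs [xsx qxs vsr vsv]]]].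
have epiq y : q y \is a fin_num -> epi q (pt y (fine (q y))).
  by move=> qy; apply/epi_pt; rewrite fineK.
have qxk k : q (xs k) \is a fin_num by have [] := vsr k.
split; first by rewrite indicator_mem//; exact: epiq.
exists (fun k => pt (xs k) (fine (q (xs k)))), (fun k => pt (l *: vs k) (- l)).
split.
- apply: cvg_pt => //.
  by apply: fine_cvg; rewrite fineK.
- rewrite indicator_mem; last exact: epiq.
  have -> : (fun k => indicator (epi q) (pt (xs k) (fine (q (xs k))))) = (fun=> 0%E).
    by apply/funext => k; rewrite indicator_mem//; exact: epiq.
  exact: cvg_cst.
- move=> k; split; first by rewrite indicator_mem//; exact: epiq.
  move=> e e0; rewrite indicator_mem; last exact: epiq.
  set z := pt _ _.
  (* The tolerance [e / l] becomes [e] once the inequality is multiplied by [l]. *)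
  have [_ /(_ _ (divr_gt0 e0 l0)) H] := vsr k.
  have zE : lsubmx z = xs k by rewrite /z row_mxKl.
  have {}H : \forall y \near z, (q (xs k) + (dot (vs k) (lsubmx y - xs k) -
      e / l * norm2 (lsubmx y - xs k))%:E <= q (lsubmx y))%E.
    have {}H : nbhs (lsubmx z) (fun y => (q (xs k) + (dot (vs k) (y - xs k) -
        e / l * norm2 (y - xs k))%:E <= q y)%E) by rewrite zE.
    exact: (@cvg_lsubmx R n 1 z _ H).
  near=> y; have H1 : (q (xs k) + (dot (vs k) (lsubmx y - xs k) -
      e / l * norm2 (lsubmx y - xs k))%:E <= q (lsubmx y))%E by near: y.
  have [u [s yE]] : exists u s, y = pt u s.
    by exists (lsubmx y), (rsubmx y 0 0); exact: pt_submx.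
  have uE : lsubmx y = u by rewrite yE row_mxKl.
  rewrite uE in H1; rewrite /indicator; case: ifPn => [|_]; last exact: leey.
  rewrite inE yE epi_pt => qy.
  move: H1; rewrite -(fineK (qxk k)) -EFinD => /le_trans/(_ qy).
  rewrite lee_fin => H1; rewrite /z ptB dot_pt dotZl add0e lee_fin.
  have := norm2_pt (u - xs k) (s - fine (q (xs k))).
  set N := norm2 _ in H1 *; set N' := norm2 _ => NN'.
  have : l * (dot (vs k) (u - xs k) - e / l * N) <= l * (s - fine (q (xs k))).
    by rewrite ler_pM2l//; lra.
  have -> : l * (dot (vs k) (u - xs k) - e / l * N) =
            l * dot (vs k) (u - xs k) - e * N by field; rewrite gt_eqF.
  by have := ler_wpM2l (ltW e0) NN'; lra.
- by apply: cvg_pt; [apply: cvgZ => //; exact: cvg_cst|exact: cvg_cst].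
Unshelve. all: by end_near. Qed.

Lemma cvg_near_seq (R : realType) (V : normedModType R) (u w : nat -> V) (l : V) :
  u @ \oo --> l -> (forall k, `|u k - w k| <= k.+1%:R^-1) -> w @ \oo --> l.
Proof.
move=> /cvgrPdist_le ul H; apply/cvgrPdist_le => e e0; have e20 : 0 < e / 2 by lra.
near=> k.
have h1 : `|l - u k| <= e / 2 by near: k; exact: ul.
have h2 : k.+1%:R^-1 < e / 2.
  by near: k; exact: (near_infty_natSinv_lt (PosNum e20)).
have -> : l - w k = (l - u k) + (u k - w k) by rewrite addrA subrK.
by rewrite (splitr e) (le_trans (ler_normD _ _))// lerD// (le_trans (H k))// ltW.
Unshelve. all: by end_near. Qed.

(** Diagonal argument: for each [k] a regular normal pair is chosen within [1 / (k + 1)] of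
    [(zs k, ws k)]. Its base point lies in [E], so the indicator values are constantly 0. *)
Lemma normal_cone_closed (R : realType) (n : nat) (E : set 'rV[R]_n)
    (z w : 'rV[R]_n) (zs ws : nat -> 'rV[R]_n) :
  E z -> zs @ \oo --> z -> ws @ \oo --> w ->
  (forall k, normal_cone E (zs k) (ws k)) -> normal_cone E z w.
Proof.
move=> Ez zsz wsw H.
have /choice[f fP] k : exists p : 'rV[R]_n * 'rV[R]_n,
    [/\ `|zs k - p.1| <= k.+1%:R^-1, `|ws k - p.2| <= k.+1%:R^-1
      & regular_subdiff (indicator (R := R) E) p.1 p.2].
  have [_ [xs [vs [/cvgrPdist_le xsz _ vsr /cvgrPdist_le vsw]]]] := H k.
  have k0 : 0 < k.+1%:R^-1 :> R by rewrite invr_gt0.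
  have : \forall j \near \oo,
      `|zs k - xs j| <= k.+1%:R^-1 /\ `|ws k - vs j| <= k.+1%:R^-1.
    by apply: filterI; [exact: xsz|exact: vsw].
  move=> [N _ HN]; have [h1 h2] := HN N (leqnn N).
  by exists (xs N, vs N); split; [exact: h1|exact: h2|exact: vsr].
split; first by rewrite indicator_mem.
exists (fun k => (f k).1), (fun k => (f k).2); split.
- by apply: (cvg_near_seq zsz) => k; have [] := fP k.
- have -> : (fun k => indicator E (f k).1) = (fun=> 0%E).
    apply/funext => k; have [_ _ [fE _]] := fP k.
    by apply: indicator_mem; exact: indicator_fin.
  by rewrite indicator_mem//; exact: cvg_cst.
- by move=> k; have [] := fP k.
- by apply: (cvg_near_seq wsw) => k; have [] := fP k.
Qed.

(** * The penalty-barrier function *)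

Lemma fin_num_EFinM (R : realType) (a : R) (x : \bar R) :
  0 < a -> (a%:E * x)%E \is a fin_num -> x \is a fin_num.
Proof.
move=> a0; case: x => // [|].
  by rewrite gt0_muley ?lte_fin.
by rewrite gt0_muleNy ?lte_fin.
Qed.

Lemma penalty_barrier_fin (R : realType) (n m meq : nat) (P : problem R n m meq)
    (b : R -> \bar R) (alpha mu : R) (x : 'rV[R]_n) :
  0 < mu -> penalty_barrier P b alpha mu x \is a fin_num ->
  [/\ objective P x \is a fin_num,
      forall i, psi b (alpha / mu) (ineq P x 0 i) \is a fin_num
    & forall j, psi_eq b (alpha / mu) (eqc P x 0 j) \is a fin_num].
Proof.
move=> mu0; rewrite !fin_numD => /andP[/andP[qx /(fin_num_EFinM mu0) h1]].
move=> /(fin_num_EFinM mu0) h2; split => // [i|j].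
  by move/sum_fin_numP: h1; apply => //; rewrite mem_index_enum.
by move/sum_fin_numP: h2; apply => //; rewrite mem_index_enum.
Qed.

(** Membership in the subdifferential includes finiteness of the penalty function at [x], hence of
    each [psi] and [psi_eq] term there. This makes the penalty terms continuously differentiable,
    and the sum rule removes them. *)
Lemma penalty_barrier_subdiff (R : realType) (n m meq : nat) (P : problem R n m meq)
    (b : R -> \bar R) (alpha mu : R) (x v : 'rV[R]_n) :
  problem_assumptions P -> is_barrier b -> 0 < alpha -> 0 < mu ->
  subdiff (penalty_barrier P b alpha mu) x v ->
  subdiff (objective P) x (v -
    ((\row_i (mu * derive1 (fine \o psi b (alpha / mu)) (ineq P x 0 i))) *m
       jac (ineq P) x +
     (\row_j (mu * derive1 (fine \o psi_eq b (alpha / mu)) (eqc P x 0 j))) *m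
       jac (eqc P) x)).
Proof.
move=> [[[qN _] _] cC ceqC _] hb a0 mu0 vx.
have rho0 : 0 < alpha / mu by exact: divr_gt0.
have [Fx _] := vx; have [_ p1 p2] := penalty_barrier_fin mu0 Fx.
have psiC (i : 'I_m) : convex_C1 (psi b (alpha / mu)).
  by have [] := psi_C1 hb rho0 (p1 i).
have psieC (j : 'I_meq) : convex_C1 (psi_eq b (alpha / mu)).
  by have [] := psi_eq_C1 hb rho0 (p2 j).
have := smoothD
  (smooth_scale mu (smooth_sum (fun i => smooth_comp (psiC i) (smooth_coord i cC))))
  (smooth_scale mu (smooth_sum (fun j => smooth_comp (psieC j) (smooth_coord j ceqC)))).
move=> /subdiff_sub_smooth/(_ qN) H.
set G := _ *m _ + _ *m _.
have -> : G = mu *: (\sum_i derive1 (fine \o psi b (alpha / mu)) (ineq P x 0 i) *: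
      row i (jac (ineq P) x)) +
    mu *: (\sum_j derive1 (fine \o psi_eq b (alpha / mu)) (eqc P x 0 j) *:
      row j (jac (eqc P) x)).
  rewrite /G !mulmx_sum_row !scaler_sumr; congr (_ + _); apply: eq_bigr => i _;
  by rewrite scalerA; congr (_ *: _); rewrite mxE.
apply: H; move: vx; congr (subdiff _ x v); apply/funext => y.
rewrite /penalty_barrier EFinD addeA !EFinM !EFin_sum_fine//.
  by move=> j _; have [+ _ _] := psieC j; apply.
by move=> i _; have [+ _ _] := psiC i; apply.
Qed.

(** The slack 1 avoids attainment of the infimum. It is harmless because the bound is later divided
    by [alpha_k], which tends to infinity. *)
Lemma dist_le_subdiff (R : realType) (n : nat) (x : 'rV[R]_n) (E : set 'rV[R]_n)
    (e : R) :
  (dist x E <= e%:E)%E -> exists2 y, E y & norm2 (x - y) < e + 1.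
Proof.
move=> H; have : (dist x E < (e + 1)%:E)%E.
  by apply: le_lt_trans H _; rewrite lte_fin ltrDl.
by move=> /ereal_inf_lt[_ [y Ey <-]]; rewrite lte_fin; exists y.
Qed.

Lemma norm_min_le (R : realType) (a c e : R) :
  0 <= a -> 0 <= c -> (e < c -> a <= e) -> `|Num.min a c| <= e.
Proof.
move=> a0 c0 H; rewrite ger0_norm ?le_min ?a0// ge_min.
by have [ce|/H->//] := leP c e; rewrite orbT.
Qed.

(** Testing the conjugate at [- h] bounds its negative by [rho * h + b (- h)], whose quotient by
    [rho] is at most [2 * h] as soon as [rho >= b (- h) / h]. *)
Lemma threshold_small (R : realType) (b : R -> \bar R) (k : nat) (e : R) :
  is_barrier b -> 0 < e -> exists M : R, forall rho, M <= rho -> 0 < rho ->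
  ((2 * k%:R)%:E * (- conjugate b rho * (rho^-1)%:E) <= e%:E)%E.
Proof.
move=> hb e0; set K : R := 2 * k%:R.
have K0 : 0 <= K by rewrite mulr_ge0.
(* Chosen so that [K * (2 * h) <= e]; [K + 1] keeps the denominator positive when [K = 0]. *)
pose h := e / (2 * (K + 1)).
have h0 : 0 < h by rewrite divr_gt0// mulr_gt0// ltr_wpDl.
have hK : K * (2 * h) <= e.
  have -> : e = (K + 1) * (2 * h) by rewrite /h; field; lra.
  by rewrite ler_wpM2r ?lerDl// mulr_ge0// ltW.
have Nh0 : - h < 0 by lra.
exists (fine (b (- h)) / h) => rho; rewrite ler_pdivrMr// => bh rho0.
apply: (@le_trans _ _ (K%:E * ((rho * h + fine (b (- h))) * rho^-1)%:E)%E).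
  rewrite lee_wpmul2l ?lee_fin// EFinM lee_wpmul2r ?lee_fin ?invr_ge0 ?(ltW rho0)//.
  rewrite leeNl; apply: ereal_sup_ubound; exists (- h) => //.
  by rewrite (barrier_fin hb Nh0) -EFinB; congr EFin; ring.
rewrite -EFinM lee_fin; apply: le_trans hK; rewrite ler_wpM2l//.
by rewrite ler_pdivrMr//; lra.
Qed.

(** * The iteration *)

(** A Bernoulli-type induction gives growth at least linear in [j] from [a N] on, which is enough
    for divergence. *)
Lemma geometric_growth_cvg (R : realType) (a : nat -> R) (kappa : R) (N : nat) :
  1 < kappa -> 0 < a N -> (forall k, (N <= k)%N -> kappa * a k <= a k.+1) ->
  a k @[k --> \oo] --> +oo.
Proof.
move=> k1 aN H.
have lin j : a N <= a (N + j)%N /\ a N + j%:R * ((kappa - 1) * a N) <= a (N + j)%N.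
  elim: j => [|j [IH1 IH2]]; first by rewrite addn0 mul0r addr0.
  have := H (N + j)%N (leq_addr _ _); rewrite addnS -natr1 => H1.
  by split; nra.
apply/cvgryPge => A.
have c0 : 0 < (kappa - 1) * a N by rewrite mulr_gt0// subr_gt0.
near=> k; have Nk : (N <= k)%N by near: k; exact: nbhs_infty_ge.
have [_] := lin (k - N)%N; rewrite subnKC// => /(le_trans _); apply.
have : `|A| / ((kappa - 1) * a N) <= (k - N)%:R.
  rewrite natrB// lerBrDr; near: k; exact: nbhs_infty_ger.
rewrite ler_pdivrMr// => kA.
by have := ler_norm A; lra.
Unshelve. all: by end_near. Qed.

Lemma geometric_decay (R : realType) (delta c e : R) :
  0 <= delta < 1 -> 0 < e -> exists N, forall k, (N <= k)%N -> delta ^+ k * c <= e.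
Proof.
move=> /andP[d0 d1] e0.
have c0 : 0 < `|c| + 1 by rewrite ltr_wpDl.
have /cvgrPdist_le/(_ _ (divr_gt0 e0 c0))[N _ HN] : (delta ^+ k) @[k --> \oo] --> (0 : R).
  by apply: cvg_expr; rewrite ger0_norm.
exists N => k /HN /=; rewrite sub0r normrN ger0_norm ?exprn_ge0// ler_pdivlMr//.
have := exprn_ge0 k d0; have := ler_norm c; nra.
Qed.

(** * Evolution of the parameters *)

Lemma reached0 (R : realType) (n m meq : nat) (P : problem R n m meq)
    (b : R -> \bar R) (par : params R) (it : iterates R n) : reached P b par it 0%N.
Proof. by []. Qed.

Lemma reachedW (R : realType) (n m meq : nat) (P : problem R n m meq)
    (b : R -> \bar R) (par : params R) (it : iterates R n) (k : nat) :
  reached P b par it k.+1 -> reached P b par it k.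
Proof. by move=> H j jk; apply: H; exact: ltnW. Qed.

Lemma alpha_step (R : realType) (n m meq : nat) (P : problem R n m meq)
    (b : R -> \bar R) (par : params R) (it : iterates R n) (k : nat) :
  generated P b par it -> reached P b par it k.+1 ->
  alpha_ it k.+1 = delta_alpha par * alpha_ it k \/ alpha_ it k.+1 = alpha_ it k.
Proof. by move=> hit /(gen_alpha hit) ->; case: ifP => _; [left|right]. Qed.

Lemma mu_step (R : realType) (n m meq : nat) (P : problem R n m meq)
    (b : R -> \bar R) (par : params R) (it : iterates R n) (k : nat) :
  generated P b par it -> reached P b par it k.+1 ->
  mu_ it k.+1 = delta_mu par * mu_ it k \/ mu_ it k.+1 = mu_ it k.
Proof. by move=> hit /(gen_mu hit) ->; case: ifP => _; [left|right]. Qed.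

Lemma alpha_mu_gt0 (R : realType) (n m meq : nat) (P : problem R n m meq)
    (b : R -> \bar R) (par : params R) (it : iterates R n) (k : nat) :
  params_assumptions par -> generated P b par it -> reached P b par it k ->
  0 < alpha_ it k /\ 0 < mu_ it k.
Proof.
move=> [_ [a0 m0] _ da [_ /andP[dm _]]] hit; elim: k => [_|k IH rk].
  by have [_ -> ->] := gen_init hit.
have [ak mk] := IH (reachedW rk); split.
  by have [->|->] := alpha_step hit rk => //; rewrite mulr_gt0// (lt_trans ltr01).
by have [->|->] := mu_step hit rk => //; rewrite mulr_gt0.
Qed.

Lemma rho_gt0 (R : realType) (n m meq : nat) (P : problem R n m meq)
    (b : R -> \bar R) (par : params R) (it : iterates R n) (k : nat) :
  params_assumptions par -> generated P b par it -> reached P b par it k ->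
  0 < rho_ it k.
Proof.
by move=> hpar hit /(alpha_mu_gt0 hpar hit)[? ?]; exact: divr_gt0.
Qed.

(** Either [alpha_k] is multiplied by [delta_alpha] while [mu_k] does not grow, or [alpha_k] is kept
    and step 8 then shrinks [mu_k]. *)
Lemma rho_growth (R : realType) (n m meq : nat) (P : problem R n m meq)
    (b : R -> \bar R) (par : params R) (it : iterates R n) (k : nat) :
  params_assumptions par -> generated P b par it -> reached P b par it k.+1 ->
  Num.min (delta_alpha par) (delta_mu par)^-1 * rho_ it k <= rho_ it k.+1.
Proof.
move=> hpar hit rk; have [_ _ _ da [_ /andP[dm0 dm1]]] := hpar.
have [ak mk] := alpha_mu_gt0 hpar hit (reachedW rk).
have [ak' mk'] := alpha_mu_gt0 hpar hit rk.
rewrite /rho_; have [aE|aE] := alpha_step hit rk.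
  rewrite aE -mulrA; apply: ler_pM.
  - by rewrite le_min invr_ge0 !ltW// (lt_trans ltr01).
  - by rewrite divr_ge0 ?ltW.
  - by rewrite ge_min lexx.
  apply: ler_wpM2l; first exact: ltW.
  rewrite lef_pV2 ?posrE//.
  have [->|->//] := mu_step hit rk.
  by rewrite ger_pMl// ltW.
have mE : mu_ it k.+1 = delta_mu par * mu_ it k.
  by rewrite (gen_mu hit rk) aE eqxx orbT.
rewrite aE mE.
have -> : alpha_ it k / (delta_mu par * mu_ it k) =
    (delta_mu par)^-1 * (alpha_ it k / mu_ it k) by rewrite invfM mulrCA.
apply: ler_wpM2r; first by rewrite divr_ge0 ?ltW.
by rewrite ge_min lexx orbT.
Qed.

Lemma rho_cvg (R : realType) (n m meq : nat) (P : problem R n m meq)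
    (b : R -> \bar R) (par : params R) (it : iterates R n) :
  params_assumptions par -> generated P b par it ->
  (forall k, reached P b par it k) -> rho_ it k @[k --> \oo] --> +oo.
Proof.
move=> hpar hit rk; have [_ _ _ da [_ /andP[dm0 dm1]]] := hpar.
apply: (@geometric_growth_cvg _ _ (Num.min (delta_alpha par) (delta_mu par)^-1) 0).
- by rewrite lt_min da/= invf_gt1.
- exact: rho_gt0 (rk 0%N).
- by move=> k _; exact: rho_growth (rk k.+1).
Qed.

(** * Multipliers and complementarity *)

Lemma approx_stationary (R : realType) (n m meq : nat) (P : problem R n m meq)
    (b : R -> \bar R) (par : params R) (it : iterates R n) (k : nat) :
  generated P b par it -> reached P b par it k ->
  exists2 v, subdiff (penalty_barrier P b (alpha_ it k) (mu_ it k)) (x_ it k) v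
    & norm2 v < eps_ it k + 1.
Proof.
move=> hit /(gen_x hit)/dist_le_subdiff[v vF]; rewrite sub0r norm2N => v1.
by exists v.
Qed.

Lemma multiplier_bounds (R : realType) (n m meq : nat) (P : problem R n m meq)
    (b : R -> \bar R) (par : params R) (it : iterates R n) (k : nat) :
  is_barrier b -> params_assumptions par -> generated P b par it ->
  reached P b par it k ->
  let db := derive1 (fine \o b) in
  let t i := ineq P (x_ it k) 0 i in
  let r j := eqc P (x_ it k) 0 j in
  let y i := y_ P b it k 0 i in
  let yeq j := yeq_ P b it k 0 j in
  [/\ forall i, 0 <= y i <= alpha_ it k,
      forall i, 0 <= t i -> y i = alpha_ it k,
      forall i, t i < 0 -> y i <= mu_ it k * db (t i),
      forall j, `|yeq j| <= alpha_ it k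
    & forall j,
        (0 < r j -> alpha_ it k - yeq j <= mu_ it k * (2 * db (- r j))) /\
        (r j < 0 -> alpha_ it k + yeq j <= mu_ it k * (2 * db (r j)))].
Proof.
move=> hb hpar hit rk /=.
have [ak mk] := alpha_mu_gt0 hpar hit rk.
have rho0 := rho_gt0 hpar hit rk.
have muE : alpha_ it k = mu_ it k * rho_ it k.
  by rewrite /rho_ mulrC divfK// gt_eqF.
(* The subgradient serves to provide finiteness of the penalty function at the iterate, which the
   derivative bounds on [psi] and [psi_eq] require. *)
have [v [Fx _] _] := approx_stationary hit rk.
have [_ p1 p2] := penalty_barrier_fin mk Fx.
split.
- move=> i; rewrite mxE; have [_ + _ _] := psi_C1 hb rho0 (p1 i).
  move=> /(_ (ineq P (x_ it k) 0 i))/andP[h1 h2].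
  by rewrite mulr_ge0 ?(ltW mk)//= muE ler_wpM2l// ltW.
- move=> i t0; rewrite mxE; have [_ _ h _] := psi_C1 hb rho0 (p1 i).
  by rewrite h// muE.
- move=> i t0; rewrite mxE; have [_ _ _ h] := psi_C1 hb rho0 (p1 i).
  by rewrite ler_wpM2l ?(ltW mk)//; exact: h.
- move=> j; rewrite mxE; have [_ h _ _] := psi_eq_C1 hb rho0 (p2 j).
  by rewrite normrM (gtr0_norm mk) muE ler_wpM2l ?(ltW mk)//; exact: h.
- move=> j; rewrite mxE muE -mulrBr -mulrDr.
  have [_ _ h1 h2] := psi_eq_C1 hb rho0 (p2 j).
  split => r0; apply: ler_wpM2l; rewrite ?(ltW mk)//; first exact: h1.
  exact: h2.
Qed.

(** A minimum exceeds [e] only if its constraint value is farther than [e] from 0. There the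
    multiplier term is 0, for [c_i > e], or at most [mu_k * 2 b'(- e)] by the monotonicity of
    [b']. *)
Lemma s_le_of_small_mu (R : realType) (n m meq : nat) (P : problem R n m meq)
    (b : R -> \bar R) (par : params R) (it : iterates R n) (k : nat) (e : R) :
  is_barrier b -> params_assumptions par -> generated P b par it ->
  reached P b par it k -> 0 < e ->
  mu_ it k * (2 * derive1 (fine \o b) (- e)) <= e -> s_ P b it k <= e.
Proof.
move=> hb hpar hit rk e0 mue.
have [ak mk] := alpha_mu_gt0 hpar hit rk.
have [y0 y1 y2 q1 q2] := multiplier_bounds hb hpar hit rk.
have Ne : - e < 0 by lra.
have dbe t : t < - e -> mu_ it k * (2 * derive1 (fine \o b) t) <= e.
  move=> te; apply: le_trans mue; do 2!(apply: ler_wpM2l; first by rewrite ?(ltW mk)).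
  by apply: barrier_derive_le => //; exact: ltW.
have pp t : 0 <= pos_part t :> R by rewrite le_max lexx.
have np t : 0 <= neg_part t :> R by rewrite le_max lexx.
rewrite /s_ ge_max; apply/andP; split; apply: bigmax_le => [|i _]; rewrite ?(ltW e0)//.
  have /andP[yi0 yi1] := y0 i.
  rewrite ge_max; apply/andP; split; apply: norm_min_le => //.
  - rewrite /neg_part lt_max ltNge (ltW e0)/= ltrNr => te.
    apply: le_trans (y2 i _) _; first by lra.
    have t0 : ineq P (x_ it k) 0 i < 0 by lra.
    have := dbe _ te; have := mulr_gt0 mk (barrier_derive_gt0 hb t0).
    by lra.
  - by rewrite subr_ge0.
  - rewrite /pos_part lt_max ltNge (ltW e0)/= => te.
    by rewrite y1 ?subrr ?ltW//; lra.
have := q1 i; rewrite ler_norml => /andP[g1 g2].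
have [h1 h2] := q2 i.
rewrite ge_max; apply/andP; split; apply: norm_min_le => //.
- by lra.
- rewrite /neg_part lt_max ltNge (ltW e0)/= ltrNr => te.
  by apply: le_trans (h2 _) _; [lra|exact: dbe].
- by lra.
- rewrite /pos_part lt_max ltNge (ltW e0)/= => te.
  by apply: le_trans (h1 _) _; [lra|apply: dbe; lra].
Qed.

(** * Termination and the tail of a run *)

Lemma eps_le (R : realType) (n m meq : nat) (P : problem R n m meq)
    (b : R -> \bar R) (par : params R) (it : iterates R n) (k : nat) :
  params_assumptions par -> generated P b par it -> reached P b par it k ->
  eps_ it k <= Num.max (delta_eps par ^+ k * eps0 par) (eps_d par).
Proof.
move=> [[_ ed0] _ _ _ [/andP[d0 d1] _]] hit; have [e00 _ _] := gen_init hit.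
elim: k => [_|k IH rk]; first by rewrite e00 expr0 mul1r le_max lexx.
rewrite (gen_eps hit rk) exprS -mulrA ge_max [X in _ && X]le_max lexx orbT andbT.
have := IH (reachedW rk); rewrite !le_max => /orP[h|h]; apply/orP.
  by left; apply: ler_wpM2l => //; exact: ltW.
by right; nra.
Qed.

Lemma stops_min (R : realType) (n m meq : nat) (P : problem R n m meq)
    (b : R -> \bar R) (par : params R) (it : iterates R n) :
  (exists k, stops P b par it k) -> exists2 k, reached P b par it k & stops P b par it k.
Proof.
move=> [k sk]; have [j /asboolP sj jmin] := ex_minnP
  (P := fun k => `[< stops P b par it k >]) (ex_intro _ k (asboolT sk)).
exists j => // i ij si; have := jmin i (asboolT si).
by rewrite leqNgt ij.
Qed.

(** Each subgradient [v] of the penalty function yields a subgradient of [q] whose distance to the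
    multiplier vector is [norm2 v], so the dual residual is at most [eps_k]. Complementarity is the
    first family of terms in [s_k]. *)
Lemma stops_KKT (R : realType) (n m meq : nat) (P : problem R n m meq)
    (b : R -> \bar R) (par : params R) (it : iterates R n) (k : nat) :
  problem_assumptions P -> is_barrier b -> params_assumptions par ->
  generated P b par it -> reached P b par it k -> stops P b par it k ->
  is_KKT P (eps_p par) (eps_d par) (x_ it k).
Proof.
move=> hP hb hpar hit rk [epsk pk sk].
have [ak mk] := alpha_mu_gt0 hpar hit rk.
have [y0 _ _ _ _] := multiplier_bounds hb hpar hit rk.
move: pk; rewrite /p_ ge_max => /andP[pk1 pk2].
exists (y_ P b it k), (yeq_ P b it k); split => //.
- apply: (@le_trans _ _ (eps_ it k)%:E); last by rewrite lee_fin.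
  apply: le_trans (gen_x hit rk); apply: le_ereal_inf_tmp => _ [v vF <-].
  apply: ereal_inf_lbound; have vq := penalty_barrier_subdiff hP hb ak mk vF.
  exists (v - (y_ P b it k *m jac (ineq P) (x_ it k) +
                yeq_ P b it k *m jac (eqc P) (x_ it k))) => //.
  congr (EFin (norm2 _)).
  by rewrite -opprD opprB addrA addNr.
- by move=> i; have /andP[] := y0 i.
move=> i; apply: le_trans sk; apply: le_trans (ler_norm _) _.
rewrite /s_ le_max; apply/orP; left.
by apply: le_trans (le_bigmax _ _ i); rewrite le_max lexx.
Qed.

(** If [mu_k] were reduced infinitely often, it would fall below [mubar]. From then on
    [s_k <= eps_p], so failure to stop means [p_k > eps_p]; as the threshold is [eps_p] by then,
    [alpha_k] is raised and [mu_k] is kept, a contradiction. *)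
Lemma never_stops_tail (R : realType) (n m meq : nat) (P : problem R n m meq)
    (b : R -> \bar R) (par : params R) (it : iterates R n) :
  is_barrier b -> params_assumptions par -> 0 < eps_p par -> 0 < eps_d par ->
  generated P b par it -> (forall k, ~ stops P b par it k) ->
  exists N, forall k, (N <= k)%N ->
    [/\ eps_ it k <= eps_d par, s_ P b it k <= eps_p par < p_ P it k,
        alpha_ it k.+1 = delta_alpha par * alpha_ it k
      & mu_ it k.+1 = mu_ it k].
Proof.
move=> hb hpar hep hed hit nstop.
have rk k : reached P b par it k by move=> j _; exact: nstop.
have [_ _ _ da [de /andP[dm0 dm1]]] := hpar.
pose dec k := (eps_p par < s_ P b it k) || (alpha_ it k.+1 == alpha_ it k).
have [N1 HN1] : exists N, forall k, (N <= k)%N -> eps_ it k <= eps_d par.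
  have /andP[de0 de1] := de.
  have [|N HN] := @geometric_decay R (delta_eps par) (eps0 par) (eps_d par) _ hed.
    by rewrite ltW.
  exists N => k Nk; apply: le_trans (eps_le hpar hit (rk k)) _.
  by rewrite ge_max lexx HN.
have [N2 HN2] : exists N, forall k, (N <= k)%N ->
    (threshold m meq b par it k < (p_ P it k)%:E)%E = (eps_p par < p_ P it k).
  have [M HM] := threshold_small (m + meq) hb hep.
  have /cvgryPge/(_ M)[N _ HN] := rho_cvg hpar hit rk.
  exists N => k /HN/= Mk; rewrite /threshold max_l ?lte_fin//.
  by apply: HM => //; exact: rho_gt0 (rk k).
(* The largest [mu_k] for which [s_le_of_small_mu] applies with [e = eps_p]. *)
pose mubar := eps_p par / (2 * derive1 (fine \o b) (- eps_p par)).
have Nep : - eps_p par < 0 by lra.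
have db0 := barrier_derive_gt0 hb Nep.
have mubar0 : 0 < mubar by rewrite divr_gt0// mulr_gt0.
pose N0 := maxn N1 N2.
have small k : (N0 <= k)%N -> mu_ it k <= mubar -> ~~ dec k.
  rewrite geq_max => /andP[/HN1 e1 /HN2 thr] muk.
  have sk : s_ P b it k <= eps_p par.
    apply: (s_le_of_small_mu hb hpar hit (rk k) hep).
    by rewrite -ler_pdivlMr// mulr_gt0.
  have pk : eps_p par < p_ P it k.
    by rewrite ltNge; apply/negP => pk; apply: (nstop k).
  rewrite /dec negb_or -leNgt sk/= (gen_alpha hit (rk k.+1)) thr pk.
  have [ak _] := alpha_mu_gt0 hpar hit (rk k).
  by rewrite gt_eqF// ltr_pMl.
have mu_le i j : (i <= j)%N -> mu_ it j <= mu_ it i.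
  move=> /subnKC <-; elim: (j - i)%N => [|l IH]; first by rewrite addn0.
  rewrite addnS; apply: le_trans IH.
  have [_ mk] := alpha_mu_gt0 hpar hit (rk (i + l)%N).
  by have [->|->] := mu_step hit (rk (i + l).+1) => //; rewrite ger_pMl// ltW.
have [N HN] : exists N, forall k, (N <= k)%N -> ~~ dec k.
  apply: contrapT => Hdec.
  have {}Hdec N : exists2 k, (N <= k)%N & dec k.
    apply: contrapT => H; apply: Hdec; exists N => k Nk.
    by apply/negP => dk; apply: H; exists k.
  have decay j : exists2 K, (N0 <= K)%N & mu_ it K <= delta_mu par ^+ j * mu_ it N0.
    elim: j => [|j [K N0K HK]]; first by exists N0; rewrite // expr0 mul1r.
    have [k Kk dk] := Hdec K; exists k.+1; first exact: leqW (leq_trans N0K Kk).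
    rewrite (gen_mu hit (rk k.+1)) -/(dec k) dk exprS -mulrA.
    by apply: ler_wpM2l; [exact: ltW|exact: le_trans (mu_le _ _ Kk) HK].
  have [|J HJ] := @geometric_decay R (delta_mu par) (mu_ it N0) mubar _ mubar0.
    by rewrite ltW.
  have [K N0K HK] := decay J; have [k Kk] := Hdec K; apply/negP/small.
    exact: leq_trans Kk.
  exact: le_trans (mu_le _ _ Kk) (le_trans HK (HJ J (leqnn J))).
exists (maxn N0 N) => k; rewrite !geq_max => /andP[/andP[/HN1 e1 /HN2 thr] /HN dk].
have := dk; rewrite /dec negb_or -leNgt => /andP[sk aN].
have muE : mu_ it k.+1 = mu_ it k.
  by rewrite (gen_mu hit (rk k.+1)) -/(dec k) (negbTE dk).
have aE := gen_alpha hit (rk k.+1); rewrite thr in aE.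
have pk : eps_p par < p_ P it k.
  (* Step 8 kept [mu_k], so [alpha_k] changed, which step 7 allows only when [p_k] exceeds the
     threshold. *)
  by apply: contraNT aN => pk; rewrite aE (negbTE pk).
by rewrite pk in aE; rewrite sk pk.
Qed.

Lemma never_stops_runs_indefinitely (R : realType) (n m meq : nat)
    (P : problem R n m meq) (b : R -> \bar R) (par : params R) (it : iterates R n) :
  is_barrier b -> params_assumptions par -> 0 < eps_p par -> 0 < eps_d par ->
  generated P b par it -> (forall k, ~ stops P b par it k) ->
  runs_indefinitely P b par it.
Proof.
move=> hb hpar hep hed hit nstop.
have rk k : reached P b par it k by move=> j _; exact: nstop.
have [_ _ _ da _] := hpar.
have [N HN] := never_stops_tail hb hpar hep hed hit nstop.
split => //.
- by exists N => // k /= /HN[].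
- move=> i j /subnKC <-; elim: (j - i)%N => [|l IH]; first by rewrite addn0.
  rewrite addnS; apply: le_trans IH _.
  have [ak _] := alpha_mu_gt0 hpar hit (rk (i + l)%N).
  by have [->|->] := alpha_step hit (rk (i + l).+1) => //; rewrite ler_peMl// ltW.
- apply: (geometric_growth_cvg (N := N) da).
    by have [] := alpha_mu_gt0 hpar hit (rk N).
  by move=> k /HN[_ _ -> _].
Qed.

(** Finitely many reductions leave [mu_k] above [delta_mu ^+ K * mu_0], where [K] is the stopping
    index or an index from which [mu_k] is constant. *)
Lemma mu_lower_bound (R : realType) (n m meq : nat) (P : problem R n m meq)
    (b : R -> \bar R) (par : params R) (it : iterates R n) :
  is_barrier b -> params_assumptions par -> 0 < eps_p par -> 0 < eps_d par ->
  generated P b par it ->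
  exists2 c, 0 < c & forall k, reached P b par it k -> c <= mu_ it k.
Proof.
move=> hb hpar hep hed hit; have [_ _ _ _ [_ /andP[dm0 dm1]]] := hpar.
have [_ m0] := alpha_mu_gt0 hpar hit (reached0 (P:=P) (b:=b) (par:=par) (it:=it)).
have geo k : reached P b par it k -> delta_mu par ^+ k * mu_ it 0%N <= mu_ it k.
  elim: k => [_|k IH rk]; first by rewrite expr0 mul1r.
  have rk' := reachedW rk; have [_ mk] := alpha_mu_gt0 hpar hit rk'.
  apply: (@le_trans _ _ (delta_mu par * mu_ it k)).
    by rewrite exprS -mulrA; apply: ler_wpM2l; [exact: ltW|exact: IH].
  by have [->|->] := mu_step hit rk => //; rewrite ger_pMl// ltW.
have bounded K :
    (forall k, reached P b par it k -> (k <= K)%N \/ mu_ it K <= mu_ it k) ->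
    reached P b par it K ->
    exists2 c, 0 < c & forall k, reached P b par it k -> c <= mu_ it k.
  move=> HK rK; exists (delta_mu par ^+ K * mu_ it 0%N).
    by rewrite mulr_gt0// exprn_gt0.
  move=> k rk; have [kK|/(le_trans (geo _ rK))//] := HK k rk.
  apply: le_trans (geo _ rk); apply: ler_wpM2r; first exact: ltW.
  by rewrite ler_wiXn2l// ltW.
have [/stops_min[K rK sK]|nstop] := pselect (exists k, stops P b par it k).
  apply: (bounded K) => // k rk; left.
  by rewrite leqNgt; apply/negP => Kk; exact: (rk K Kk sK).
have {}nstop k : ~ stops P b par it k by move=> sk; apply: nstop; exists k.
have rk k : reached P b par it k by move=> j _; exact: nstop.
have [N HN] := never_stops_tail hb hpar hep hed hit nstop.
apply: (bounded N) => // k _; have [kN|/ltnW Nk] := leqP k N; [by left|right].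
rewrite -(subnKC Nk); elim: (k - N)%N => [|l IH]; first by rewrite addn0.
by rewrite addnS; have [_ _ _ ->] := HN (N + l)%N (leq_addr _ _).
Qed.

(** * Accumulation points *)

Lemma cvg_mulmx (R : realType) (T : Type) (F : set_system T) {FF : Filter F}
    (m n p : nat) (A : T -> 'M[R]_(m, n)) (B : T -> 'M[R]_(n, p))
    (A0 : 'M[R]_(m, n)) (B0 : 'M[R]_(n, p)) :
  A @ F --> A0 -> B @ F --> B0 -> (A x *m B x) @[x --> F] --> A0 *m B0.
Proof.
move=> AA0 BB0; apply: (@cvg_mx R T F FF) => i j; rewrite mxE.
have -> : (fun x => (A x *m B x) i j) = (fun x => \sum_k A x i k * B x k j).
  by apply/funext => x; rewrite mxE.
apply: cvg_big => [|k _]; first exact: add_continuous.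
by apply: cvgM; exact: cvg_coord.
Qed.

(** Subsequences are encoded by [k <= f k] instead of strict monotonicity: this sends [f] to
    infinity and is stable under composition. *)
Lemma cvg_subseq (T : Type) (u : nat -> T) (G : set_system T) (f : nat -> nat) :
  (forall k, (k <= f k)%N) -> u @ \oo --> G -> u (f k) @[k --> \oo] --> G.
Proof.
move=> kf ul A /ul[N _ HN]; exists N => // k /= Nk.
exact: HN (leq_trans Nk (kf k)).
Qed.

Lemma cluster_subseq (R : realType) (V : normedModType R) (u : nat -> V) (p : V) :
  cluster (u @ \oo) p ->
  exists2 f : nat -> nat, (forall k, (k <= f k)%N) & u (f k) @[k --> \oo] --> p.
Proof.
move=> up.
have /choice[f fP] k : exists j, (k <= j)%N /\ `|p - u j| <= k.+1%:R^-1.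
  have k0 : 0 < k.+1%:R^-1 :> R by rewrite invr_gt0.
  have [] := up (u @` [set j | (k <= j)%N]) (ball p k.+1%:R^-1).
  - by exists k => // j /= kj; exists j.
  - exact: nbhsx_ballx.
  move=> _ [[j /= kj <-] pj]; exists j; split => //.
  by apply: ltW; move: pj; rewrite -ball_normE.
exists f; first by move=> k; have [] := fP k.
apply: (cvg_near_seq (u := fun=> p)); first exact: cvg_cst.
by move=> k; have [] := fP k.
Qed.

Lemma bounded_rV_subseq (R : realType) (m : nat) (u : nat -> 'rV[R]_m) :
  (forall k i, `|u k 0 i| <= 1) ->
  exists (f : nat -> nat) (l : 'rV[R]_m),
    (forall k, (k <= f k)%N) /\ u (f k) @[k --> \oo] --> l.
Proof.
move=> H.
have cK : compact [set v : 'rV[R]_m | forall i, v ord0 i \in `[(-1 : R), 1]].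
  apply: (@rV_compact R m (fun=> `[(-1 : R), 1]%classic)) => _.
  exact: segment_compact.
have [|l [_ /cluster_subseq[f kf fl]]] := cK (u @ \oo) _.
  by exists 0%N => // k _ i /=; rewrite in_itv/= -ler_norml; exact: H.
by exists f, l.
Qed.

(** If [abar > 0], then [r k * a k] is unbounded, while [t k < tbar / 2 < 0] eventually keeps the
    right-hand side below [2 b'(tbar / 2)]. *)
Lemma multiplier_limit_le0 (R : realType) (b : R -> \bar R) (a t r : nat -> R)
    (abar tbar : R) :
  is_barrier b -> a k @[k --> \oo] --> abar -> t k @[k --> \oo] --> tbar ->
  r k @[k --> \oo] --> +oo ->
  (forall k, t k < 0 -> r k * a k <= 2 * derive1 (fine \o b) (t k)) ->
  tbar < 0 -> abar <= 0.
Proof.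
move=> hb aa tt /cvgryPge rr H t0; rewrite leNgt; apply/negP => a0.
have t20 : tbar / 2 < 0 by lra.
pose C := 2 * derive1 (fine \o b) (tbar / 2).
have C0 : 0 < C by rewrite mulr_gt0// barrier_derive_gt0.
suff : \forall k \near \oo, False by case=> N _ /(_ N (leqnn N)).
near=> k.
have tk : t k < tbar / 2 by near: k; apply: (cvgr_lt tbar) => //; lra.
have ak : abar / 2 < a k by near: k; apply: (cvgr_gt abar) => //; lra.
(* With [a k > abar / 2], this makes [r k * a k] exceed [C]. *)
have rk : 2 * C / abar + 1 <= r k by near: k; exact: rr.
have rk' : 2 * C / abar < r k by lra.
have {rk'} Crk : 2 * C < r k * abar by rewrite -ltr_pdivrMr.
have tk0 : t k < 0 by lra.
have := H k tk0; have := barrier_derive_le hb (ltW tk) t20.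
have r0 : 0 < r k by apply: lt_le_trans rk; rewrite ltr_wpDl// divr_ge0 ?ltW// mulr_gt0.
rewrite /C in Crk *; nra.
Unshelve. all: by end_near. Qed.

Lemma pos_part_subgradient (R : realType) (t a s : R) :
  0 <= a <= 1 -> (t < 0 -> a = 0) -> (0 < t -> a = 1) ->
  pos_part t + a * (s - t) <= pos_part s.
Proof.
move=> /andP[a0 a1] h1 h2; rewrite /pos_part.
have [t0|t0|t0] := ltgtP t 0.
- by rewrite h1// mul0r addr0 le_max lexx.
- by rewrite h2// mul1r addrC subrK le_max lexx orbT.
- rewrite t0 add0r subr0 le_max.
  by have [s0|s0] := leP 0 s; apply/orP; [right|left]; nra.
Qed.

Lemma norm_subgradient (R : realType) (t a s : R) :
  `|a| <= 1 -> (t < 0 -> a = -1) -> (0 < t -> a = 1) ->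
  `|t| + a * (s - t) <= `|s|.
Proof.
rewrite ler_norml => /andP[a0 a1] h1 h2.
have s1 := ler_norm s; have s2 := ler_norm (- s); rewrite normrN in s2.
have [t0|t0|t0] := ltgtP t 0.
- by rewrite h1// ltr0_norm//; lra.
- by rewrite h2// gtr0_norm//; lra.
- by rewrite t0 normr0; have [s0|s0] := leP 0 s; nra.
Qed.

(** Ensures that the points [(x_k, q(x_k))] of the epigraph converge to [(xbar, q(xbar))]. *)
Lemma cvg_of_edom_closed (R : realType) (n : nat) (q : 'rV[R]_n -> \bar R)
    (xs : nat -> 'rV[R]_n) (x : 'rV[R]_n) :
  closed (edom q) -> {within edom q, continuous q} ->
  (forall k, edom q (xs k)) -> xs @ \oo --> x ->
  edom q x /\ q (xs k) @[k --> \oo] --> q x.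
Proof.
move=> qcl qc qxs xsx.
have qx : edom q x by apply: (@closed_cvg _ _ _ _ xs _ qcl _ x xsx); exact: nearW.
split => //; have /subspace_continuousP/(_ x qx) qcx := qc.
move=> A /qcx /xsx[N _ HN]; exists N => // k Nk.
by apply: (HN k Nk); exact: qxs.
Qed.

Definition scaled_y (R : realType) (n m meq : nat) (P : problem R n m meq)
    (b : R -> \bar R) (it : iterates R n) (k : nat) : 'rV[R]_m :=
  (alpha_ it k)^-1 *: y_ P b it k.

Definition scaled_yeq (R : realType) (n m meq : nat) (P : problem R n m meq)
    (b : R -> \bar R) (it : iterates R n) (k : nat) : 'rV[R]_meq :=
  (alpha_ it k)^-1 *: yeq_ P b it k.

(** Since [rho_k / alpha_k = 1 / mu_k], multiplying by [rho_k] cancels the factor [mu_k] in the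
    earlier bounds. All the bounds then have the form required by [multiplier_limit_le0]. *)
Lemma scaled_multiplier_bounds (R : realType) (n m meq : nat) (P : problem R n m meq)
    (b : R -> \bar R) (par : params R) (it : iterates R n) (k : nat) :
  is_barrier b -> params_assumptions par -> generated P b par it ->
  reached P b par it k ->
  let db := derive1 (fine \o b) in
  let t i := ineq P (x_ it k) 0 i in
  let r j := eqc P (x_ it k) 0 j in
  let y i := scaled_y P b it k 0 i in
  let yeq j := scaled_yeq P b it k 0 j in
  [/\ forall i, 0 <= y i <= 1,
      forall i, (0 < t i -> rho_ it k * (1 - y i) <= 2 * db (- t i)) /\
                (t i < 0 -> rho_ it k * y i <= 2 * db (t i)),
      forall j, `|yeq j| <= 1
    & forall j, (0 < r j -> rho_ it k * (1 - yeq j) <= 2 * db (- r j)) /\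
                (r j < 0 -> rho_ it k * (1 + yeq j) <= 2 * db (r j))].
Proof.
move=> hb hpar hit rk /=.
have [ak mk] := alpha_mu_gt0 hpar hit rk.
have [h1 h2 h3 h4 h5] := multiplier_bounds hb hpar hit rk.
have rhoE z : rho_ it k * ((alpha_ it k)^-1 * z) = (mu_ it k)^-1 * z.
  by rewrite /rho_; field; rewrite !gt_eqF.
have rho1 : rho_ it k = (mu_ it k)^-1 * alpha_ it k by rewrite /rho_ mulrC.
split.
- move=> i; rewrite mxE mulrC; have /andP[y0 y1] := h1 i.
  by rewrite divr_ge0 ?(ltW ak)//= ler_pdivrMr// mul1r.
- move=> i; rewrite mxE mulrBr mulr1 rhoE rho1 -mulrBr; split => t0.
    rewrite h2; last exact: ltW.
    rewrite subrr mulr0; apply: mulr_ge0 => //; apply: ltW.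
    by apply: barrier_derive_gt0; rewrite // oppr_lt0.
  rewrite mulrC ler_pdivrMr// mulrC; apply: le_trans (h3 _ t0) _.
  by have := mulr_gt0 mk (barrier_derive_gt0 hb t0); lra.
- move=> j; rewrite mxE normrM gtr0_norm ?invr_gt0// mulrC.
  by rewrite ler_pdivrMr// mul1r.
- move=> j; have [q1 q2] := h5 j; rewrite mxE mulrBr mulrDr mulr1 rhoE rho1.
  rewrite -mulrBr -mulrDr; split => r0; rewrite mulrC ler_pdivrMr// [leRHS]mulrC.
    exact: q1.
  exact: q2.
Qed.

Lemma limit_multipliers (R : realType) (n m meq : nat) (P : problem R n m meq)
    (b : R -> \bar R) (par : params R) (it : iterates R n) (s : nat -> nat)
    (x : 'rV[R]_n) (y : 'rV[R]_m) (yeq : 'rV[R]_meq) :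
  C1 (ineq P) -> C1 (eqc P) ->
  is_barrier b -> params_assumptions par -> generated P b par it ->
  (forall k, reached P b par it k) -> (forall k, (k <= s k)%N) ->
  x_ it (s k) @[k --> \oo] --> x ->
  scaled_y P b it (s k) @[k --> \oo] --> y ->
  scaled_yeq P b it (s k) @[k --> \oo] --> yeq ->
  (forall i r, pos_part (ineq P x 0 i) + y 0 i * (r - ineq P x 0 i) <= pos_part r) /\
  (forall j r, `|eqc P x 0 j| + yeq 0 j * (r - eqc P x 0 j) <= `|r|).
Proof.
move=> [cd _] [ceqd _] hb hpar hit rk ks xs ys yeqs.
have rhos : rho_ it (s k) @[k --> \oo] --> +oo.
  exact: cvg_subseq ks (rho_cvg hpar hit rk).
have ts i : ineq P (x_ it (s k)) 0 i @[k --> \oo] --> ineq P x 0 i.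
  apply: (@cvg_coord R _ \oo _ _ _ (fun k => ineq P (x_ it (s k)))).
  by apply: (cvg_comp _ _ xs); exact: (differentiable_continuous (cd x)).
have rs j : eqc P (x_ it (s k)) 0 j @[k --> \oo] --> eqc P x 0 j.
  apply: (@cvg_coord R _ \oo _ _ _ (fun k => eqc P (x_ it (s k)))).
  by apply: (cvg_comp _ _ xs); exact: (differentiable_continuous (ceqd x)).
split => [i r|j r].
- have yi : scaled_y P b it (s k) 0 i @[k --> \oo] --> y 0 i by exact: cvg_coord.
  have y01 : 0 <= y 0 i <= 1.
    apply/andP; split.
      apply: (cvgr_to_ge yi); apply: nearW => k.
      by have [+ _ _ _] :=
        scaled_multiplier_bounds hb hpar hit (rk (s k)) => /(_ i)/andP[].
    apply: (cvgr_to_le yi); apply: nearW => k.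
    by have [+ _ _ _] :=
        scaled_multiplier_bounds hb hpar hit (rk (s k)) => /(_ i)/andP[].
  have /andP[y0 y1] := y01.
  apply: pos_part_subgradient => // t0; apply/eqP; rewrite eq_le ?y0 ?y1 ?andbT//=.
    apply: (multiplier_limit_le0 hb yi (ts i) rhos _ t0) => k.
    by have [_ + _ _] :=
        scaled_multiplier_bounds hb hpar hit (rk (s k)) => /(_ i)[].
  rewrite -subr_le0.
  (* For a positive limit constraint value the same lemma is applied to [1 - y] along the negated
     values. *)
  apply: (@multiplier_limit_le0 R b (fun k => 1 - scaled_y P b it (s k) 0 i)
    (fun k => - ineq P (x_ it (s k)) 0 i) _ _ (- ineq P x 0 i) hb _ _ rhos).
  + by apply: cvgB => //; exact: cvg_cst.
  + exact: cvgN.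
  + move=> k; rewrite oppr_lt0.
    by have [_ + _ _] :=
        scaled_multiplier_bounds hb hpar hit (rk (s k)) => /(_ i)[].
  + by rewrite oppr_lt0.
- have yj : scaled_yeq P b it (s k) 0 j @[k --> \oo] --> yeq 0 j by exact: cvg_coord.
  have y1 : `|yeq 0 j| <= 1.
    apply: (cvgr_to_le (cvg_norm yj)); apply: nearW => k.
    by have [_ _ + _] := scaled_multiplier_bounds hb hpar hit (rk (s k)); apply.
  have := y1; rewrite ler_norml => /andP[y2 y3].
  apply: norm_subgradient => // r0; apply/eqP; rewrite eq_le ?y2 ?y3 ?andbT//=.
    rewrite -subr_le0 opprK addrC.
    apply: (@multiplier_limit_le0 R b (fun k => 1 + scaled_yeq P b it (s k) 0 j)
      (fun k => eqc P (x_ it (s k)) 0 j) _ _ (eqc P x 0 j) hb _ (rs j) rhos) => //.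
      by apply: cvgD => //; exact: cvg_cst.
    move=> k.
    by have [_ _ _ +] :=
        scaled_multiplier_bounds hb hpar hit (rk (s k)) => /(_ j)[].
  rewrite -subr_le0.
  apply: (@multiplier_limit_le0 R b (fun k => 1 - scaled_yeq P b it (s k) 0 j)
    (fun k => - eqc P (x_ it (s k)) 0 j) _ _ (- eqc P x 0 j) hb _ _ rhos).
  + by apply: cvgB => //; exact: cvg_cst.
  + exact: cvgN.
  + move=> k; rewrite oppr_lt0.
    by have [_ _ _ +] :=
        scaled_multiplier_bounds hb hpar hit (rk (s k)) => /(_ j)[].
  + by rewrite oppr_lt0.
Qed.

Lemma accumulation_KKT_feasibility (R : realType) (n m meq : nat)
    (P : problem R n m meq) (b : R -> \bar R) (par : params R) (it : iterates R n)
    (xbar : 'rV[R]_n) :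
  problem_assumptions P -> is_barrier b -> params_assumptions par ->
  generated P b par it -> runs_indefinitely P b par it ->
  closed (edom (objective P)) -> {within edom (objective P), continuous (objective P)} ->
  cluster (x_ it k @[k --> \oo]) xbar -> KKT_feasibility P xbar.
Proof.
move=> hP hb hpar hit [nstop _ _ alphay] qcl qc /cluster_subseq[f kf xf].
have [[[qN _] _] cC ceqC _] := hP; have [[_ ed0] _ ed _ [/andP[de0 de1] _]] := hpar.
have rk k : reached P b par it k by move=> j _; exact: nstop.
have ak k : 0 < alpha_ it k by have [] := alpha_mu_gt0 hpar hit (rk k).
have mk k : 0 < mu_ it k by have [] := alpha_mu_gt0 hpar hit (rk k).
have /choice[v vP] k : exists v,
    subdiff (penalty_barrier P b (alpha_ it k) (mu_ it k)) (x_ it k) v /\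
    norm2 v < eps0 par + 1.
  have [v vF vn] := approx_stationary hit (rk k); exists v; split => //.
  apply: lt_le_trans vn _; rewrite lerD2r.
  apply: le_trans (eps_le hpar hit (rk k)) _; rewrite ge_max ed andbT.
  by rewrite ler_piMl ?(le_trans ed0 ed)// exprn_ile1// ltW.
have qfin k : objective P (x_ it k) \is a fin_num.
  by have [[Fx _] _] := vP k; have [] := penalty_barrier_fin (mk k) Fx.
(* Two successive extractions make the iterates and both families of scaled multipliers converge
   along [s = f \o g \o h]. *)
have [|g [ybar [kg yg]]] := @bounded_rV_subseq R m (fun k => scaled_y P b it (f k)).
  move=> k i; have [+ _ _ _] := scaled_multiplier_bounds hb hpar hit (rk (f k)).
  by move=> /(_ i)/andP[y0 y1]; rewrite ger0_norm.
have [|h [yeqbar [kh yh]]] :=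
    @bounded_rV_subseq R meq (fun k => scaled_yeq P b it (f (g k))).
  move=> k j; have [_ _ + _] := scaled_multiplier_bounds hb hpar hit (rk (f (g k))).
  exact.
pose s k := f (g (h k)).
have ks k : (k <= s k)%N.
  by apply: leq_trans (kf _); apply: leq_trans (kg _); exact: kh.
have xs : x_ it (s k) @[k --> \oo] --> xbar.
  exact: (cvg_subseq kh (cvg_subseq kg xf)).
have ys : scaled_y P b it (s k) @[k --> \oo] --> ybar by exact: (cvg_subseq kh yg).
have qedom k : edom (objective P) (x_ it (s k)) by rewrite /edom/= ltey_eq qfin.
have [qx qxs] := cvg_of_edom_closed qcl qc qedom xs.
have qxfin : objective P xbar \is a fin_num.
  by rewrite fin_numE (lt_eqF qx) andbT; exact/eqP/qN.
have [hy hyeq] := limit_multipliers cC ceqC hb hpar hit rk ks xs ys yh.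
have [G GE] : exists G, G = ybar *m jac (ineq P) xbar + yeqbar *m jac (eqc P) xbar.
  by eexists.
split => //; exists G; first by rewrite GE; exact: infeasibility_subdiff.
(* The last coordinate 0 is the limit of [- 1 / alpha_k], and [- G] is the limit of the scaled
   subgradients of [q]. *)
exists (pt (- G) 0); last by rewrite ptD subrr addr0 /pt raddf0 row_mx0.
have alphaV : (alpha_ it k)^-1 @[k --> \oo] --> (0 : R).
  by apply/(gtr0_cvgV0 (f := alpha_ it)) => //; exact: nearW.
have vto0 : (alpha_ it k)^-1 *: v k @[k --> \oo] --> (0 : 'rV[R]_n).
  have C0 : 0 < eps0 par + 1 by rewrite ltr_wpDl// (le_trans ed0 ed).
  apply/cvgrPdist_le => e e0; near=> k; rewrite sub0r normrN normrZ.
  rewrite gtr0_norm ?invr_gt0//.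
  have aC : (alpha_ it k)^-1 <= e / (eps0 par + 1).
    near: k; have /cvgrPdist_le/(_ _ (divr_gt0 e0 C0)) := alphaV.
    by apply: filterS => k; rewrite sub0r normrN gtr0_norm ?invr_gt0.
  have -> : e = e / (eps0 par + 1) * (eps0 par + 1) by rewrite divfK// gt_eqF.
  apply: ler_pM => //; first by rewrite invr_ge0 ltW.
  apply: le_trans (mx_norm_le_norm2 _) _; by have [_ /ltW] := vP k.
pose w k := v k - (y_ P b it k *m jac (ineq P) (x_ it k) +
                   yeq_ P b it k *m jac (eqc P) (x_ it k)).
have wq k : subdiff (objective P) (x_ it k) (w k).
  by apply: penalty_barrier_subdiff => //; have [] := vP k.
have wE k : (alpha_ it k)^-1 *: w k = (alpha_ it k)^-1 *: v k -
    (scaled_y P b it k *m jac (ineq P) (x_ it k) +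
     scaled_yeq P b it k *m jac (eqc P) (x_ it k)).
  by rewrite scalerBr scalerDr !scalemxAl.
apply: (@normal_cone_closed R (n + 1) _ _ _
  (fun k => pt (x_ it (s k)) (fine (objective P (x_ it (s k)))))
  (fun k => pt ((alpha_ it (s k))^-1 *: w (s k)) (- (alpha_ it (s k))^-1))).
- by apply/epi_pt; rewrite fineK.
- by apply: cvg_pt => //; apply: fine_cvg; rewrite fineK.
- apply: cvg_pt; last first.
    by rewrite -oppr0; apply: cvgN; exact: (cvg_subseq ks alphaV).
  have -> : (fun k => (alpha_ it (s k))^-1 *: w (s k)) = (fun k =>
      (alpha_ it (s k))^-1 *: v (s k) -
      (scaled_y P b it (s k) *m jac (ineq P) (x_ it (s k)) +
       scaled_yeq P b it (s k) *m jac (eqc P) (x_ it (s k)))).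
    by apply/funext => k; exact: wE.
  rewrite -[- G]sub0r; apply: cvgB; first exact: (cvg_subseq ks vto0).
  have [_ cj] := cC; have [_ ceqj] := ceqC.
  rewrite GE; apply: cvgD; apply: cvg_mulmx => //.
    by apply: (cvg_comp _ _ xs); exact: cj.
  by apply: (cvg_comp _ _ xs); exact: ceqj.
- by move=> k; apply: subdiff_epi_normal; [rewrite invr_gt0|exact: wq].
Unshelve. all: by end_near. Qed.

Theorem theorem4p5 (R : realType) (n m meq : nat) (P : problem R n m meq)
    (b : R -> \bar R) (par : params R) (it : iterates R n)
    (hP : problem_assumptions P) (hb : is_barrier b)
    (hpar : params_assumptions par)
    (hep : 0 < eps_p par) (hed : 0 < eps_d par)
    (hit : generated P b par it) :
  [/\ 0 < inf [set mu_ it k | k in reached P b par it],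
      (terminates_KKT P b par it \/ runs_indefinitely P b par it) /\
      ~ (terminates_KKT P b par it /\ runs_indefinitely P b par it)
    & runs_indefinitely P b par it ->
      closed (edom (objective P)) -> {within edom (objective P), continuous (objective P)} ->
      forall xbar : 'rV[R]_n,
        cluster (x_ it k @[k --> \oo]) xbar -> KKT_feasibility P xbar].
Proof.
split.
- have [c c0 Hc] := mu_lower_bound hb hpar hep hed hit.
  apply: lt_le_trans c0 _; apply: lb_le_inf.
    by exists (mu_ it 0%N); exists 0%N.
  by move=> _ [k rk <-]; exact: Hc.
- split; last by move=> [[k [_ sk _]] [nstop _ _ _]]; exact: nstop k sk.
  have [/stops_min[k rk sk]|nstop] := pselect (exists k, stops P b par it k).
    left; exists k; split; [exact: rk|exact: sk|].
    exact: (stops_KKT hP hb hpar hit rk sk).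
  right; apply: (never_stops_runs_indefinitely hb hpar hep hed hit) => k sk.
  by apply: nstop; exists k.
- move=> hrun qcl qc xbar.
  exact: (accumulation_KKT_feasibility hP hb hpar hit hrun qcl qc).
Qed.
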